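(* Let $\mu\in\mathcal{P}_1$, $a=\operatorname{Re} m_1(\mu)$ and $b=\operatorname{Im} m_1(\mu)$, where $m_1(\mu)$ is the first complex moment of $\mu$. Then the probability measures $\mu_N^M:=(D_{1/N}\mu)^{\rhd N}$ converge weakly, as $N\to\infty$, to the Cauchy distribution $\mu_{a,b}$, where, if $b=0$, $\mu_{a,0}$ is understood to be $\delta_a$.
   Context: Class $\mathcal{P}_1$: a positive measure $\lambda$ on $\mathbb{R}$ satisfies property (A2) if there exist $0<r<R$ and a real analytic function $p(x)=\sum_{n=2}^\infty\frac{a_n}{x^n}$, absolutely convergent for $|x|>r$ and non-negative on $|x|\ge R$, such that $\lambda(dx)=p(x)\mathbf{1}_{\{|x|\ge R\}}(x)\,dx$. $\mathcal{P}_1$ consists of the probability measures on $\mathbb{R}$ of the form $\mu=\nu+\lambda$, where $\nu$ is a positive measure with compact support and $\lambda$ satisfies (A2). Complex moments: for $\lambda$ satisfying (A2), $m_n(\lambda)=\int_{\gamma_R}z^np(z)\,dz$, where $p(z)=\sum_{n\ge 2}a_nz^{-n}$ for $|z|>r$ and $\gamma_R=\{Re^{i\theta} : 0\le\theta\le\pi\}$ is oriented counterclockwise. For $\mu=\nu+\lambda\in\mathcal{P}_1$, $m_n(\mu)=\int_{\mathbb{R}}x^n\nu(dx)+m_n(\lambda)$; this does not depend on the decomposition, and $\operatorname{Im}m_1(\mu)\ge0$. Cauchy distribution: $\mu_{a,b}(dx)=\frac1\pi\frac{b}{(x-a)^2+b^2}dx$ for $a\in\mathbb{R}$, $b>0$.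 Dilation: $\int f(x)(D_c\mu)(dx)=\int f(cx)\mu(dx)$ for all bounded continuous $f$. Monotone convolution: with $\mathbb{C}_-=\{\operatorname{Im}z<0\}$, $G_\mu(z)=\int_{\mathbb{R}}\frac{\mu(dx)}{z-x}$ and $F_\mu=1/G_\mu$, the monotone convolution $\mu_1\rhd\mu_2$ of probability measures is characterized by $F_{\mu_1\rhd\mu_2}(z)=F_{\mu_1}(F_{\mu_2}(z))$ for $z\in\mathbb{C}_-$; $\mu^{\rhd N}$ is the $N$-fold monotone convolution power. *)

(* Defs.v *)
From HB Require Import structures.
From mathcomp Require Import all_boot all_order all_algebra.
From mathcomp.real_closed Require Import complex.
From mathcomp Require Import all_classical all_reals all_analysis.
From mathcomp Require Import measurable_realfun.

Set Implicit Arguments.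
Unset Strict Implicit.
Unset Printing Implicit Defensive.
Import Order.TTheory GRing.Theory Num.Theory.
Import numFieldNormedType.Exports.
Local Open Scope classical_set_scope.
Local Open Scope ring_scope.
Local Open Scope complex_scope.

(* [Re] and [Im] alone denote the Num.ClosedField versions, with values in R[i];
   these are the R-valued projections. *)
Local Notation Re := complex.Re.
Local Notation Im := complex.Im.

Section complex_integrals.
Context {R : realType}.

Definition Cintegral d (T : measurableType d)
    (m : {measure set T -> \bar R}) (D : set T) (f : T -> R[i]) : R[i] :=
  (\int[m]_(x in D) Re (f x)) +i* (\int[m]_(x in D) Im (f x)).

Definition contour_integral (g : R -> R[i]) (s t : R) (f : R[i] -> R[i]) :
    R[i] :=
  Cintegral (@lebesgue_measure R) `[s, t]
    (fun u : R => f (g u) *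
      (derive1 (fun v => Re (g v)) u +i* derive1 (fun v => Im (g v)) u)).

Definition half_circle (R0 : R) (theta : R) : R[i] :=
  (R0 * cos theta) +i* (R0 * sin theta).

End complex_integrals.

(* sum_(k >= 2) c_k / z^k; used both for K = R and for K = R[i] *)
Definition laurent_tail (K : numFieldType) (c : nat -> K) (z : K) : K :=
  limn (fun n => \sum_(2 <= k < n) c k / z ^+ k).

Section class_P1.
Context {R : realType}.
Local Notation measureR := {measure set (measurableTypeR R) -> \bar R}.
Local Notation probR := (probability (measurableTypeR R) R).
Implicit Types (nu lam : measureR) (mu : probR).

(* lam satisfies (A2) with radii r < R0 and p(x) = sum_(k >= 2) a_k / x^k *)
Definition A2_with (r R0 : R) (a : nat -> R) lam : Prop :=
  [/\ 0 < r, r < R0,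
      forall x : R, r < `|x| ->
        cvgn (fun n => \sum_(2 <= k < n) `|a k / x ^+ k|),
      forall x : R, R0 <= `|x| -> 0 <= laurent_tail a x &
      forall A, measurable A ->
        lam A = (\int[lebesgue_measure]_(x in A)
          (laurent_tail a x * \1_[set y : R | R0 <= `|y|] x)%:E)%E].

Definition A2 lam : Prop := exists r R0 a, A2_with r R0 a lam.

Definition compactly_supported nu : Prop :=
  exists2 K : set R, compact K & nu (~` K) = 0%E.

Definition P1_decomposition mu nu lam : Prop :=
  [/\ compactly_supported nu, A2 lam &
      forall A, measurable A -> mu A = (nu A + lam A)%E].

Definition P1 mu : Prop := exists nu lam, P1_decomposition mu nu lam.

(* The complex moments are given as relations "m is the n-th complex moment",
   since they are computed from a non-unique representation. *)
Definition is_A2_moment lam (n : nat) (m : R[i]) : Prop :=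
  exists r R0 a, A2_with r R0 a lam /\
    m = contour_integral (half_circle R0) 0 pi
          (fun z => z ^+ n * laurent_tail (fun k => (a k)%:C) z).

Definition is_complex_moment mu (n : nat) (m : R[i]) : Prop :=
  exists nu lam ml, [/\ P1_decomposition mu nu lam, is_A2_moment lam n ml &
    m = (\int[nu]_x (x ^+ n))%:C + ml].

End class_P1.

Section dilation.
Context {R : realType}.
Local Notation probR := (probability (measurableTypeR R) R).

Definition scale_fun (c : R) : measurableTypeR R -> measurableTypeR R :=
  fun x => c * x.

Lemma measurable_scale_fun (c : R) : measurable_fun setT (scale_fun c).
Proof. exact: mulrl_measurable. Qed.

HB.instance Definition _ (c : R) :=
  isMeasurableFun.Build _ _ _ _ (scale_fun c) (measurable_scale_fun c).

Definition dilation (c : R) (mu : probR) : probR :=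
  distribution mu (scale_fun c).

Lemma dilationE (c : R) (mu : probR) (f : R -> R) :
  continuous f -> bounded_fun f ->
  \int[dilation c mu]_x f x = \int[mu]_x f (c * x).
Proof.
move=> cf bf.
have mf : measurable_fun [set: measurableTypeR R] f.
  exact: continuous_measurable_fun.
have mfc : measurable_fun [set: measurableTypeR R] (f \o scale_fun c).
  by apply: measurableT_comp; [exact: mf|exact: measurable_scale_fun].
rewrite /Rintegral (integral_distribution (X := scale_fun c))//.
  apply/measurable_EFinP.
  exact: mf.
apply: (measurable_bounded_integrable (mu := mu) (f := f \o scale_fun c)) => //.
  by rewrite (le_lt_trans (probability_le1 _ _)) ?ltry.
have [M [Mr MP]] := bf.
by exists M; split => // M' MM' x _; exact: MP.
Qed.

End dilation.

Section monotone_convolution.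
Context {R : realType}.
Local Notation probR := (probability (measurableTypeR R) R).
Implicit Types mu nu : probR.

Definition cauchy_transform mu (z : R[i]) : R[i] :=
  Cintegral mu setT (fun x => (z - x%:C)^-1).

Definition F_transform mu (z : R[i]) : R[i] := (cauchy_transform mu z)^-1.

(* mu is the monotone convolution of mu1 and mu2 *)
Definition is_monotone_convolution mu1 mu2 mu : Prop :=
  forall z : R[i], Im z < 0 ->
    F_transform mu z = F_transform mu1 (F_transform mu2 z).

(* is_monotone_power mu N nu : nu is the N-fold monotone convolution power of
   mu, N >= 1 *)
Inductive is_monotone_power mu : nat -> probR -> Prop :=
| monotone_power1 : is_monotone_power mu 1 mu
| monotone_powerS N rho nu :
    is_monotone_power mu N rho -> is_monotone_convolution rho mu nu ->
    is_monotone_power mu N.+1 nu.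

End monotone_convolution.

Definition weak_cvg (R : realType)
    (mu_ : nat -> probability (measurableTypeR R) R)
    (mu : probability (measurableTypeR R) R) : Prop :=
  forall f : R -> R, continuous f -> bounded_fun f ->
    \int[mu_ n]_x f x @[n --> \oo] --> \int[mu]_x f x.

Section cauchy_distribution.
Context {R : realType}.
Variables a b : R.

Definition cauchy_pdf (x : R) : R := pi^-1 * (b / ((x - a) ^+ 2 + b ^+ 2)).

(* The Dirac mass at a when b = 0; the case b < 0 is only there to make the
   definition total. *)
Definition cauchy_prob (A : set (measurableTypeR R)) : \bar R :=
  if 0 < b then (\int[lebesgue_measure]_(x in A) (cauchy_pdf x)%:E)%E
  else (\d_a A)%E.

Lemma cauchy_pdf_ge0 x : 0 < b -> 0 <= cauchy_pdf x.
Proof.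
move=> b0; rewrite /cauchy_pdf mulr_ge0 ?invr_ge0 ?pi_ge0//.
by rewrite divr_ge0 ?(ltW b0)// addr_ge0 ?sqr_ge0.
Qed.

Lemma continuous_cauchy_pdf : 0 < b -> continuous cauchy_pdf.
Proof.
move=> b0 x; apply: cvgM; first exact: cvg_cst.
apply: cvgM; first exact: cvg_cst.
apply: cvgV; first by rewrite gt_eqF// ltr_wpDl ?sqr_ge0// exprn_gt0.
apply: cvgD; last exact: cvg_cst.
apply: (cvg_comp (fun y : R => y - a) (fun y => y ^+ 2)); last first.
  exact: exprn_continuous.
by apply: cvgB; [exact: cvg_id|exact: cvg_cst].
Qed.

Lemma measurable_cauchy_pdf : 0 < b -> measurable_fun setT cauchy_pdf.
Proof.
by move=> b0; apply: continuous_measurable_fun; exact: continuous_cauchy_pdf.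
Qed.

Lemma integral_cauchy_pdf : 0 < b ->
  (\int[lebesgue_measure]_x (cauchy_pdf x)%:E = 1)%E.
Proof.
move=> b0.
pose F := fun x : R => b * x + a.
have dF (x : R) : is_derive x (1 : R) F b.
  have -> : F = (b \*: (@id R)) + cst a by [].
  by apply: is_derive_eq; rewrite addr0 /GRing.scale/= mulr1.
have F'E : F^`()%classic = cst b.
  by apply/funext => x; rewrite derive1E; apply: derive_val.
have cEx : (\int[lebesgue_measure]_x (pi^-1 * (oneDsqr x)^-1)%:E = 1 :> \bar R)%E.
  have oV0 (x : R) : 0 <= (oneDsqr x)^-1 by rewrite invr_ge0 addr_ge0 ?sqr_ge0.
  have cV : continuous (fun x : R => (oneDsqr x)^-1).
    exact: continuous_oneDsqrV.
  under eq_integral do rewrite EFinM.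
  rewrite ge0_integralZl//=; last 2 first.
  - by apply/measurable_EFinP; exact: continuous_measurable_fun.
  - by rewrite lee_fin invr_ge0 pi_ge0.
  rewrite ge0_symfun_integralT//; last first.
    by move=> x; rewrite /= /oneDsqr sqrrN.
  rewrite -set_itvcy integral0y_oneDsqr -!EFinM; congr EFin.
  have p0 : (pi : R) != 0 by rewrite gt_eqF// pi_gt0.
  by rewrite [X in _ * X]mulrC divfK ?pnatr_eq0// mulVf.
rewrite (@increasing_ge0_integration_by_substitutionT _ F cauchy_pdf); first last.
- by move=> x; exact: cauchy_pdf_ge0.
- exact: continuous_cauchy_pdf.
- apply: (cvg_comp (fun x : R => b * x) (fun x => x + a)).
    by apply: gt0_cvgMry => //; exact: cvg_id.
  exact: cvg_addrr.
- apply: (cvg_comp (fun x : R => b * x) (fun x => x + a)).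
    by apply: gt0_cvgMrNy => //; exact: cvg_id.
  exact: cvg_addrr_Ny.
- by move=> x; exact: ex_derive.
- by rewrite F'E; exact: is_cvg_cst.
- by rewrite F'E; exact: is_cvg_cst.
- by rewrite F'E => x; exact: cvg_cst.
- by move=> x y xy; rewrite ltrD2r ltr_pM2l.
rewrite -[RHS]cEx; apply: eq_integral => x _; congr EFin.
rewrite F'E mulrfctE /= /F /cauchy_pdf /oneDsqr addrK.
have x1 : 1 + x ^+ 2 != 0 by rewrite gt_eqF// ltr_pwDl ?sqr_ge0.
rewrite -mulrA exprMn -[X in _ + X]mulr1 -mulrDr [x ^+ 2 + 1]addrC invfM.
have bN0 : b != 0 by rewrite gt_eqF.
by congr (_ * _); rewrite mulrAC mulrA -expr2 mulfV ?expf_neq0// mul1r.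
Qed.

Let cauchy0 : cauchy_prob set0 = 0%E.
Proof. by rewrite /cauchy_prob; case: ifPn => _; rewrite ?integral_set0. Qed.

Let cauchy_ge0 A : (0 <= cauchy_prob A)%E.
Proof.
rewrite /cauchy_prob; case: ifPn => // b0.
by apply: integral_ge0 => x _; rewrite lee_fin cauchy_pdf_ge0.
Qed.

Let cauchy_sigma_additive : semi_sigma_additive cauchy_prob.
Proof.
move=> F mF tF mUF; rewrite /cauchy_prob; case: ifPn => b0; last first.
  exact: measure_semi_sigma_additive.
apply: cvg_toP.
  apply: ereal_nondecreasing_is_cvgn => m n mn.
  apply: lee_sum_nneg_natr => // k _ _; apply: integral_ge0 => /= x Fkx.
  by rewrite lee_fin cauchy_pdf_ge0.
rewrite ge0_integral_bigcup//=.
- apply/measurable_funTS/measurableT_comp => //.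
  exact: measurable_cauchy_pdf.
- by move=> x _; rewrite lee_fin cauchy_pdf_ge0.
Qed.

HB.instance Definition _ := isMeasure.Build _ _ _
  cauchy_prob cauchy0 cauchy_ge0 cauchy_sigma_additive.

Let cauchy_setT : cauchy_prob setT = 1%E.
Proof.
rewrite /cauchy_prob; case: ifPn => b0; first exact: integral_cauchy_pdf.
exact: probability_setT.
Qed.

HB.instance Definition _ :=
  @Measure_isProbability.Build _ _ R cauchy_prob cauchy_setT.

End cauchy_distribution.

(* Main.v *)
(* The proof has two halves.  First, for [w] in the lower half-plane,
   [w^2 G(w) - w] is the integral of [w x / (w - x)] against the measure.  On
   the exterior set [|x| >= R] one has [x p(x) = a_2 / x + O(x^-2)]: the
   [O(x^-2)] part and the compactly supported part converge to their first
   moments as [w] tends to infinity non-tangentially, whereas [1 / x]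
   contributes [i pi].  Integrating [z p(z)] term by term over the half circle
   gives the same limit, so that [F(w) = w - m_1 + o(1)], and [Im m_1 = pi a_2]
   is non-negative because [x^2 p(x)] tends to [a_2].  Hence the transform of
   the dilated measure is [z - m_1 / N + o(1 / N)], and its [N]-fold iterate,
   whose intermediate points stay in a compact part of the lower half-plane,
   tends to [z - m_1].

   Second, the imaginary part of the Cauchy transform at [t - i y] is, up to a
   factor [pi], the convolution of the measure with a Cauchy density.  By
   Tonelli and Fatou its pointwise convergence gives
   [liminf \int f dmu_n >= \int f dmu] for non-negative bounded Lipschitz [f],
   then for bounded continuous [f] by Lipschitz minorants; applying this to
   [K + f] and [K - f] yields weak convergence. *)

Require Import Defs.
From mathcomp Require Import all_boot all_order all_algebra.
From mathcomp.real_closed Require Import complex.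
From mathcomp Require Import all_classical all_reals all_analysis.
From mathcomp Require Import measurable_realfun.
From mathcomp Require Import ring lra.
Set Implicit Arguments.
Unset Strict Implicit.
Unset Printing Implicit Defensive.
Import Order.TTheory GRing.Theory Num.Theory.
Import numFieldNormedType.Exports.
Local Open Scope classical_set_scope.
Local Open Scope ring_scope.

(** * Integration *)

(** When [a_2] is nonzero, [x] is not integrable against the measure, so [w x / (w - x)] has no
    integrable majorant uniform in [w], and dominated convergence alone cannot produce [m_1]. Only
    the term [a_2 / x] of [x p(x)] is responsible. It meets the factor [x (1 / x + 1 / (w - x))],
    and the integral of [1 / x + 1 / (w - x)] over the exterior set is explicit: its real part has a
    logarithmic primitive, its imaginary part is a Poisson kernel of total mass [pi].

    In the iteration [N] errors accumulate, so each has to be [o(1 / N)]. Dilation supplies this: it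
    evaluates [F] at [N z], which stays in a fixed cone, and divides the result by [N]. The sign of
    [Im m_1] makes each step move the point downwards, away from the real axis, up to that error.

    The limit [1 / (z - m_1)] at [z = t - i y] has imaginary part [pi] times the Cauchy density of
    scale [b + y] at [t]. This also makes sense for [b = 0], so the Dirac case runs along. All
    measures involved have mass one; this is why lower bounds for non-negative functions are enough
    and no mass can escape to infinity. *)

Section density.
Local Open Scope ereal_scope.
Context d (T : measurableType d) (R : realType).
Variables (mu nu : {measure set T -> \bar R}) (g : T -> R).
Hypothesis mg : measurable_fun setT g.
Hypothesis g0 : forall x, (0 <= g x)%R.
Hypothesis nuE : forall A, measurable A -> nu A = \int[mu]_(x in A) (g x)%:E.
Import HBNNSimple.

(** [nuE] is the case of indicators. Linearity extends it to simple functions, and monotone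
    convergence along [nnsfun_approx], applied on both sides, does the rest. *)
Lemma ge0_integral_density (f : T -> \bar R) :
  (forall x, 0 <= f x) -> measurable_fun setT f ->
  \int[nu]_x f x = \int[mu]_x (f x * (g x)%:E).
Proof.
move=> f0 mf; pose h := nnsfun_approx measurableT mf.
have mgE : measurable_fun setT (EFin \o g) by exact/measurable_EFinP.
have -> : \int[nu]_x f x = limn (fun n => \int[nu]_x (EFin \o h n) x).
  rewrite -monotone_convergence//.
  - by apply: eq_integral => x _; apply/esym/cvg_lim => //;
    exact: cvg_nnsfun_approx.
  - by move=> n; apply/measurable_EFinP; exact/measurable_funP.
  - by move=> n x _; rewrite lee_fin.
  - by move=> x _ a b ab; rewrite lee_fin; exact/lefP/nd_nnsfun_approx.
have -> : \int[mu]_x (f x * (g x)%:E) =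
    limn (fun n => \int[mu]_x ((EFin \o h n) x * (g x)%:E)).
  rewrite -monotone_convergence//.
  - apply: eq_integral => x _; apply/esym/cvg_lim => //.
    by apply: cvgeZr => //; exact: cvg_nnsfun_approx.
  - by move=> n; apply/emeasurable_funM => //; exact/measurable_EFinP.
  - by move=> n x _; rewrite mule_ge0 ?lee_fin.
  - move=> x _ a b ab; rewrite lee_wpmul2r ?lee_fin//.
    exact/lefP/nd_nnsfun_approx.
congr (limn _); apply/funext => n.
have mi r : measurable_fun setT (fun x => (r * \1_(h n @^-1` [set r]) x)%:E).
  by apply/measurable_EFinP; exact: measurable_funM.
transitivity (\int[nu]_x
   (\sum_(y \in range (h n)) (y * \1_(h n @^-1` [set y]) x)%:E)).
  by apply: eq_integral => t _; rewrite /= fimfunE -fsumEFin.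
rewrite ge0_integral_fsum//; last by move=> m y _; exact: nnfun_muleindic_ge0.
transitivity (\int[mu]_x (\sum_(y \in range (h n))
    (y * \1_(h n @^-1` [set y]) x)%:E * (g x)%:E)); last first.
  apply: eq_integral => x _.
  rewrite -ge0_mule_fsuml => [|y]; last exact: nnfun_muleindic_ge0.
  by rewrite fsumEFin// -(fimfunE _ x).
rewrite ge0_integral_fsum//; last 2 first.
  - by move=> y; apply: emeasurable_funM.
  - by move=> m y _; apply: mule_ge0;
    [exact: nnfun_muleindic_ge0|rewrite lee_fin].
apply: eq_fsbigr => r rhn.
under eq_integral do rewrite EFinM.
rewrite integralZl_indic_nnsfun => //.
under [RHS]eq_integral do rewrite EFinM -muleA.
rewrite ge0_integralZl//.
- under [in RHS]eq_integral do rewrite muleC.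
  rewrite [in RHS](eq_integral ((EFin \o g) \_ (h n @^-1` [set r])));
    last first.
    by move=> x xE; rewrite epatch_indic.
  by rewrite -integral_mkcond -nuE// integral_indic// setIT.
- by apply: emeasurable_funM => //; exact/measurable_EFinP.
- by move=> t _; rewrite mule_ge0 ?lee_fin.
- by move: rhn; rewrite inE => -[t _ <-]; rewrite lee_fin.
Qed.

(** Positive and negative parts are transported separately, which works because multiplication by
    [g >= 0] commutes with taking the maximum with 0. The equality thus holds for every measurable
    [f], integrable or not. *)
Lemma Rintegral_density (f : T -> R) : measurable_fun setT f ->
  (\int[nu]_x f x = \int[mu]_x (f x * g x))%R.
Proof.
move=> mf; have mfE : measurable_fun setT (EFin \o f) by exact/measurable_EFinP.
rewrite /Rintegral; congr fine.
rewrite integralE [RHS]integralE; congr (_ - _).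
- rewrite ge0_integral_density//; last exact: measurable_funepos.
  apply: eq_integral => x _; rewrite !funeposE -!EFin_max -EFinM.
  by rewrite maxr_pMl// mul0r.
- rewrite ge0_integral_density//; last exact: measurable_funeneg.
  apply: eq_integral => x _; rewrite !funenegE -!EFin_max -EFinM.
  by rewrite maxr_pMl// mul0r mulNr.
Qed.

End density.

Section real_integrals.
Context d (T : measurableType d) (R : realType).
Variables (mu : {measure set T -> \bar R}) (D : set T) (mD : measurable D).

Lemma le_Rintegrable (f g : T -> R) : measurable_fun D f ->
  (forall x, D x -> `|f x| <= g x) -> mu.-integrable D (EFin \o g) ->
  mu.-integrable D (EFin \o f).
Proof.
move=> mf fg ig; apply: (le_integrable mD _ _ ig); first exact/measurable_EFinP.
by move=> x Dx /=; rewrite lee_fin (le_trans (fg _ Dx))// ler_norm.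
Qed.

Lemma RintegrableZl (k : R) (f : T -> R) : mu.-integrable D (EFin \o f) ->
  mu.-integrable D (EFin \o (fun x => k * f x)).
Proof.
by move=> /(integrableZl mD k); apply: eq_integrable => // x _;
  rewrite /= EFinM.
Qed.

Lemma RintegrableD (f g : T -> R) : mu.-integrable D (EFin \o f) ->
  mu.-integrable D (EFin \o g) ->
  mu.-integrable D (EFin \o (fun x => f x + g x)).
Proof. by move=> /(integrableD mD) /[apply]. Qed.

Lemma RintegrableB (f g : T -> R) : mu.-integrable D (EFin \o f) ->
  mu.-integrable D (EFin \o g) ->
  mu.-integrable D (EFin \o (fun x => f x - g x)).
Proof. by move=> /(integrableB mD) /[apply]. Qed.

Lemma Rdominated_convergence (f_ : nat -> T -> R) (f g : T -> R) :
  (forall n, measurable_fun D (f_ n)) ->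
  (forall x, D x -> f_ n x @[n --> \oo] --> f x) ->
  mu.-integrable D (EFin \o g) ->
  (forall n x, D x -> `|f_ n x| <= g x) ->
  mu.-integrable D (EFin \o f) /\
  \int[mu]_(x in D) f_ n x @[n --> \oo] --> \int[mu]_(x in D) f x.
Proof.
move=> mf_ f_f ig f_g.
have mf : measurable_fun D f by exact: measurable_fun_cvg mf_ f_f.
have [] := @dominated_convergence _ _ _ mu D mD (fun n => EFin \o f_ n)
  (EFin \o f) (EFin \o g) _ _ _ ig.
- by move=> n; exact/measurable_EFinP.
- exact/measurable_EFinP.
- by apply: aeW => x Dx; apply/fine_cvgP; split; [exact: nearW|exact: f_f].
- by apply: aeW => x n Dx; rewrite lee_fin f_g.
move=> intf _ cvgf; split => //.
by apply: fine_cvg; rewrite fineK//; exact: integrable_fin_num.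
Qed.

Lemma le_dist_Rintegral (f h g : T -> R) : mu.-integrable D (EFin \o f) ->
  mu.-integrable D (EFin \o h) -> mu.-integrable D (EFin \o g) ->
  (forall x, D x -> `|f x - h x| <= g x) ->
  `|\int[mu]_(x in D) f x - \int[mu]_(x in D) h x| <= \int[mu]_(x in D) g x.
Proof.
move=> iF ih ig fhg; rewrite -RintegralB//.
have ifh := RintegrableB iF ih.
rewrite (le_trans (le_normr_Rintegral _ _))// le_Rintegral//.
exact: integrable_norm.
Qed.

End real_integrals.

(** The cut at 1 matters: [|x| g(x)] need not be integrable, whereas the truncated weight is at most
    1 and tends to 0 pointwise, so [g] itself is a majorant. The later use is with the Laurent
    remainder, which is only O(x^-2). *)
Lemma Rintegral_minr_cvg0 (R : realType)
    (mu : {measure set (measurableTypeR R) -> \bar R})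
    (g : measurableTypeR R -> R) (e : R) :
  mu.-integrable setT (EFin \o g) -> (forall x, 0 <= g x) -> 0 < e ->
  exists2 C : R, 0 < C &
    forall c, C <= c -> \int[mu]_x (g x * Num.min (`|x| / c) 1) <= e.
Proof.
move=> ig g0 e0.
have mg : measurable_fun setT g by apply/measurable_EFinP;
  exact: measurable_int ig.
have mm (c : R) : measurable_fun setT (fun x : measurableTypeR R => g x *
  Num.min (`|x| / c) 1).
  apply: measurable_funM => //; apply: measurable_minr => //.
  by apply: measurable_funM => //; exact: normr_measurable.
have mb (c x : R) : 0 < c -> `|g x * Num.min (`|x| / c) 1| <= g x.
  move=> c0; rewrite normrM (ger0_norm (g0 x)) ler_piMr//.
  rewrite ger0_norm; first by rewrite ge_min lexx orbT.
  by rewrite le_min ler01 andbT divr_ge0// ltW.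
have im (c : R) : 0 < c ->
    mu.-integrable setT (EFin \o (fun x => g x * Num.min (`|x| / c) 1)).
  by move=> c0; apply: le_Rintegrable ig => // x _; exact: mb.
have cvg0 : \int[mu]_x (g x * Num.min (`|x| / n.+1%:R) 1) @[n --> \oo] -->
    \int[mu]_x (cst 0 x : R).
  apply: (Rdominated_convergence _ _ _ ig _).2 => //.
  - move=> x _.
    apply: (@squeeze_cvgr _ _ _ _ (cst 0) (fun n => (g x * `|x|) * n.+1%:R^-1)).
    + near=> n; rewrite mulr_ge0//= ?le_min ?ler01 ?andbT ?divr_ge0//.
      by rewrite -mulrA ler_wpM2l// ge_min lexx.
    + exact: cvg_cst.
    + by rewrite -[cst 0 x](mulr0 (g x * `|x|)); apply: cvgMl_tmp;
      exact: cvg_harmonic.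
  - by move=> n x _; apply: (mb n.+1%:R).
move: cvg0; rewrite /= Rintegral_cst// mul0r => /cvgrPdist_le /(_ _ e0)[N _ NP].
(* The weight decreases in [c], so one integer controls all larger real [c]. *)
exists N.+1%:R => // c Nc.
have c0 : 0 < c by exact: lt_le_trans Nc.
apply: (@le_trans _ _ (\int[mu]_x (g x * Num.min (`|x| / N.+1%:R) 1))).
  apply: le_Rintegral => //.
  - exact: im c0.
  - by apply: im; exact: ltr0Sn.
  move=> x _; apply: ler_wpM2l; first exact: g0.
  apply: le_min2; last exact: lexx.
  apply: ler_wpM2l; first exact: normr_ge0.
  by rewrite lef_pV2// posrE ltr0Sn.
have := NP N (leqnn _); rewrite /= sub0r normrN; exact/le_trans/ler_norm.
Unshelve. all: by end_near. Qed.

(** * Weak convergence from Cauchy transforms *)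

Section poisson_kernel.
Context {R : realType}.
Local Notation leb := (@lebesgue_measure R : {measure set (measurableTypeR R)
  -> \bar R}).
Implicit Types (a b x t : R) (f : R -> R).

Lemma integrable_cauchy_pdf a b : 0 < b ->
  leb.-integrable setT (EFin \o cauchy_pdf a b).
Proof.
move=> b0; apply/integrableP; split.
  by apply/measurable_EFinP; exact: measurable_cauchy_pdf.
under eq_integral do rewrite /= (ger0_norm (cauchy_pdf_ge0 _ _ b0)).
by rewrite integral_cauchy_pdf// ltry.
Qed.

Lemma Rintegral_cauchy_pdf a b : 0 < b -> \int[leb]_x cauchy_pdf a b x = 1.
Proof. by move=> b0; rewrite /Rintegral integral_cauchy_pdf. Qed.

Lemma integrableM_cauchy_pdf f (K : R) a b : 0 < b -> measurable_fun setT f ->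
  (forall x, `|f x| <= K) ->
  leb.-integrable setT (EFin \o (fun t => f t * cauchy_pdf a b t)).
Proof.
move=> b0 mf fK.
apply: (le_Rintegrable measurableT _ _
  (RintegrableZl measurableT K (integrable_cauchy_pdf a b0))).
- by apply: measurable_funM => //; exact: measurable_cauchy_pdf.
- move=> x _; rewrite normrM (ger0_norm (cauchy_pdf_ge0 _ _ b0)).
  by apply: ler_wpM2r; [exact: cauchy_pdf_ge0|exact: fK].
Qed.

(* Splitting at |t - x| = d and using [1 <= 2 s^2 / (s^2 + d^2)] for [d <= |s|]
   keeps the error a multiple of a Cauchy density. *)
Lemma poisson_approx f (K e d : R) x b :
  measurable_fun setT f -> (forall t, 0 <= f t <= K) ->
  (forall t, `|t - x| < d -> `|f t - f x| <= e) ->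
  0 < d -> 0 <= e -> 0 < b ->
  `|\int[leb]_t (f t * cauchy_pdf x b t) - f x| <= e + 2 * K * (b / d).
Proof.
move=> mf fK fd d0 e0 b0.
have K0 : 0 <= K by have /andP[] := fK x; exact: le_trans.
have P0 t : 0 <= cauchy_pdf x b t by exact: cauchy_pdf_ge0.
have iP := integrable_cauchy_pdf x b0.
have iPd := integrable_cauchy_pdf x d0.
have fn t : `|f t| <= K by have /andP[? ?] := fK t; rewrite ger0_norm.
have -> : f x = \int[leb]_t (f x * cauchy_pdf x b t).
  by rewrite RintegralZl// Rintegral_cauchy_pdf// mulr1.
have -> : e + 2 * K * (b / d) = \int[leb]_t (e * cauchy_pdf x b t +
    2 * K * (b / d) * cauchy_pdf x d t).
  rewrite RintegralD//; last 2 first.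
  - exact: RintegrableZl.
  - exact: RintegrableZl.
  rewrite (RintegralZl _ _ iP)// (RintegralZl _ _ iPd)//.
  by rewrite !Rintegral_cauchy_pdf// !mulr1.
apply: (le_dist_Rintegral measurableT (integrableM_cauchy_pdf x b0 mf fn)
  (RintegrableZl measurableT (f x) iP)
  (RintegrableD measurableT (RintegrableZl measurableT e iP)
    (RintegrableZl measurableT (2 * K * (b / d)) iPd))).
move=> t _; rewrite -mulrBl normrM (ger0_norm (P0 t)).
have Q0 : 0 <= 2 * K * (b / d) * cauchy_pdf x d t.
  apply: mulr_ge0; last exact: cauchy_pdf_ge0.
  by apply: mulr_ge0; [exact: mulr_ge0|rewrite divr_ge0// ltW].
have [td|td] := ltP (`|t - x|) d.
  rewrite -[X in X <= _]addr0 lerD//.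
  by rewrite ler_wpM2r// fd.
rewrite -[X in X <= _]add0r lerD ?(mulr_ge0 e0 (P0 t))//.
have : `|f t - f x| <= K.
  have /andP[f0 f1] := fK t; have /andP[g0 g1] := fK x.
  by rewrite ler_norml; apply/andP; split; lra.
move=> /(ler_wpM2r (P0 t)) /le_trans; apply.
have : 0 <= pi^-1 :> R by rewrite invr_ge0 pi_ge0.
rewrite /cauchy_pdf; move: pi^-1 => q q0.
have -> : 2 * K * (b / d) * (q * (d / ((t - x) ^+ 2 + d ^+ 2))) =
    K * (q * (b * (2 / ((t - x) ^+ 2 + d ^+ 2)))).
  by field; rewrite (gt_eqF d0) gt_eqF// ltr_wpDl ?sqr_ge0// exprn_gt0.
rewrite ler_wpM2l// ler_wpM2l// ler_wpM2l ?(ltW b0)//.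
have s0 : d ^+ 2 <= (t - x) ^+ 2.
  by rewrite -(real_normK (num_real (t - x))) lerXn2r// nnegrE ltW.
have d20 : 0 < d ^+ 2 by exact: exprn_gt0.
have b20 : 0 < b ^+ 2 by exact: exprn_gt0.
rewrite -[X in X <= _]mul1r ler_pdivrMr; last by lra.
rewrite mulrAC ler_pdivlMr; last by lra.
lra.
Qed.

End poisson_kernel.

(** The lower limit is the supremum of the tail infima; a tail whose infimum exceeds the integral of
    [g] minus [e] provides the rank. The integrals of [g_ n] are kept in the extended reals, since
    they may be infinite. *)
Lemma fatou_eventually d (T : measurableType d) (R : realType)
    (mu : {measure set T -> \bar R}) (g_ : nat -> T -> R) (g : T -> R) (e : R) :
  (forall n, measurable_fun setT (g_ n)) -> (forall n x, 0 <= g_ n x) ->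
  (forall x, g_ n x @[n --> \oo] --> g x) ->
  mu.-integrable setT (EFin \o g) -> 0 < e ->
  \forall n \near \oo,
    ((\int[mu]_x g x - e)%:E <= \int[mu]_x (g_ n x)%:E)%E.
Proof.
move=> mg_ g_0 g_g ig e0.
have := @fatou _ _ _ mu setT measurableT (fun n => EFin \o g_ n).
have -> : (\int[mu]_x limn_einf (fun n => (EFin \o g_ n) x) =
    (\int[mu]_x g x)%:E)%E.
  rewrite /Rintegral fineK; last exact: integrable_fin_num.
  apply: eq_integral => x _.
  have cg : (EFin \o g_ n) x @[n --> \oo] --> (g x)%:E.
    by apply/fine_cvgP; split; [exact: nearW|exact: g_g].
  rewrite is_cvg_limn_einfE; last by apply/cvg_ex; exists (g x)%:E.
  exact/cvg_lim.
move=> le_fatou.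
have {le_fatou} : ((\int[mu]_x g x)%:E <=
    limn_einf (fun n => \int[mu]_x (EFin \o g_ n) x))%E.
  apply: le_fatou; first by move=> n; exact/measurable_EFinP.
  by move=> n x _; rewrite lee_fin.
rewrite limn_einf_lim => H.
have : ((\int[mu]_x g x - e)%:E <
    ereal_sup (range (einfs (fun n => \int[mu]_x (EFin \o g_ n) x))))%E.
  apply: (@lt_le_trans _ _ (\int[mu]_x g x)%:E);
    first by rewrite lte_fin ltrBlDr ltrDl.
  apply: (le_trans H); rewrite (cvg_lim _ (@cvg_einfs_sup _ _))//.
move=> /ereal_sup_gt[_ [N _ <-] /ltW leN].
exists N => // n /= Nn; apply: (le_trans leN).
by apply: ereal_inf_lbound; exists n.
Qed.

(** * Lipschitz regularization from below *)

Section lower_regularization.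
Context {R : realType}.
Variable f : R -> R.
Hypothesis f0 : forall x, 0 <= f x.
Implicit Types (k x : R).

(** The Pasch-Hausdorff envelope, that is, the infimal convolution of [f] with [k |.|]: the largest
    [k]-Lipschitz function below [f]. *)
Definition lipschitz_minorant k x : R :=
  inf (range (fun y => f y + k * `|x - y|)).

Let has_lb k x : 0 <= k -> has_lbound (range (fun y => f y + k * `|x - y|)).
Proof. by move=> k0; exists 0 => _ [y _ <-]; rewrite addr_ge0 ?mulr_ge0. Qed.

Lemma lipschitz_minorant_ge0 k x : 0 <= k -> 0 <= lipschitz_minorant k x.
Proof.
move=> k0; apply: lb_le_inf; first by exists (f x + k * `|x - x|), x.
by move=> _ [y _ <-]; rewrite addr_ge0 ?mulr_ge0.
Qed.

Lemma lipschitz_minorant_le k x : 0 <= k -> lipschitz_minorant k x <= f x.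
Proof.
move=> k0; apply: ge_inf; first exact: has_lb.
by exists x => //; rewrite subrr normr0 mulr0 addr0.
Qed.

Lemma lipschitz_minorant_lipschitz k x y : 0 <= k ->
  `|lipschitz_minorant k x - lipschitz_minorant k y| <= k * `|x - y|.
Proof.
move=> k0; suff H u v : lipschitz_minorant k u <= lipschitz_minorant k v + k *
  `|u - v|.
  rewrite ler_norml lerBlDl H andbT.
  by have := H y x; rewrite distrC; lra.
rewrite -lerBlDr; apply: lb_le_inf; first by exists (f v + k * `|v - v|), v.
move=> _ [w _ <-]; rewrite lerBlDr.
apply: (@le_trans _ _ (f w + k * `|u - w|)).
  by apply: ge_inf; [exact: has_lb|exists w].
rewrite -addrA lerD2l -mulrDr ler_wpM2l//.
by have := ler_normD (u - v) (v - w); rewrite addrA subrK [leRHS]addrC.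
Qed.

Lemma lipschitz_minorant_continuous k : 0 <= k ->
  continuous (lipschitz_minorant k).
Proof.
move=> k0 x; apply/cvgrPdist_le => r r0; near=> t.
apply: (le_trans (lipschitz_minorant_lipschitz _ _ k0)).
apply: (@le_trans _ _ (k * (r / (k + 1)))).
  apply: ler_wpM2l => //; near: t; apply: cvgr_dist_le; first exact: cvg_id.
  by rewrite divr_gt0// ltr_wpDl.
by rewrite mulrCA ler_piMr ?(ltW r0)// ler_pdivrMr ?ltr_wpDl// mul1r lerDl.
Unshelve. all: by end_near. Qed.

Lemma lipschitz_minorant_cvg x : {for x, continuous f} ->
  lipschitz_minorant n%:R x @[n --> \oo] --> f x.
Proof.
move=> /cvgrPdist_le cf; apply/cvgrPdist_le => e e0.
have /nbhs_ballP[d /= d0 xd] := cf _ e0.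
(* This rank makes [n d >= f x]: a competitor [y] at distance at least [d] from [x] pays a penalty
   of at least [f x], and [f y >= 0] only adds to it. Nearer competitors are handled by
   continuity. *)
exists (Num.truncn (f x / d)).+1 => // n /= nN.
have n0 : 0 <= n%:R :> R by [].
rewrite ger0_norm ?subr_ge0 ?lipschitz_minorant_le//.
rewrite lerBlDl -lerBlDr; apply: lb_le_inf;
  first by exists (f x + n%:R * `|x - x|), x.
move=> _ [y _ <-]; rewrite lerBlDr.
have [xy|xy] := ltP `|x - y| d.
  have := xd y xy; rewrite /= => /ler_normlW.
  by have := mulr_ge0 n0 (normr_ge0 (x - y)); lra.
have : f x <= n%:R * `|x - y|.
  apply: (@le_trans _ _ (n%:R * d)); last by rewrite ler_wpM2l.
  rewrite -ler_pdivrMr//; apply: (@le_trans _ _ (Num.truncn (f x / d)).+1%:R).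
    by rewrite ltW// truncnS_gt.
  by rewrite ler_nat.
by have := f0 y; lra.
Qed.

End lower_regularization.

Section weak_convergence.
Context {R : realType}.
Local Notation leb := (@lebesgue_measure R : {measure set (measurableTypeR R)
  -> \bar R}).
Local Notation probR := (probability (measurableTypeR R) R).
Implicit Types (a b x y t : R) (f : R -> R) (mu : probR).

Lemma cauchy_pdf_sym x b t : cauchy_pdf x b t = cauchy_pdf t b x.
Proof. by rewrite /cauchy_pdf -sqrrN opprB. Qed.

Lemma integrable_prob mu f (K : R) : measurable_fun setT f ->
  (forall x, `|f x| <= K) -> mu.-integrable setT (EFin \o f).
Proof.
move=> mf fK; apply: (measurable_bounded_integrable (mu := mu)) => //.
  by rewrite (le_lt_trans (probability_le1 _ _)) ?ltry.
exists K; split; first exact: num_real.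
by move=> M KM x _; exact: le_trans (fK x) (ltW KM).
Qed.

Lemma cauchy_pdf_le a b x : 0 < b -> cauchy_pdf a b x <= (pi * b)^-1.
Proof.
move=> b0; rewrite /cauchy_pdf invfM; apply: ler_wpM2l.
  by rewrite invr_ge0 pi_ge0.
have b20 : 0 < b ^+ 2 by exact: exprn_gt0.
by rewrite ler_pdivrMr ?ltr_wpDl ?sqr_ge0// ler_pdivlMl// -expr2 lerDr sqr_ge0.
Qed.

Lemma measurable_smoothing f b : measurable_fun setT f -> 0 < b ->
  measurable_fun setT (fun z : measurableTypeR R * measurableTypeR R =>
    f z.2 * cauchy_pdf z.1 b z.2).
Proof.
move=> mf b0; apply: measurable_funM.
  by apply: measurableT_comp => //; exact: measurable_snd.
have -> : (fun z : measurableTypeR R * measurableTypeR R => cauchy_pdf z.1 b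
  z.2) =
    cauchy_pdf 0 b \o (fun z => z.2 - z.1).
  by apply/funext => z; rewrite /= /cauchy_pdf subr0.
apply: measurableT_comp; first exact: measurable_cauchy_pdf.
by apply: measurable_funB; [exact: measurable_snd|exact: measurable_fst].
Qed.

(** The symmetry of the kernel in [x] and [t] moves the smoothing from the function to the measure,
    and smoothed measures are what Cauchy transforms control. *)
Lemma tonelli_poisson mu f b : measurable_fun setT f -> (forall x, 0 <= f x) ->
  0 < b ->
  (\int[mu]_x \int[leb]_t (f t * cauchy_pdf x b t)%:E =
   \int[leb]_t (f t * \int[mu]_x cauchy_pdf t b x)%:E)%E.
Proof.
move=> mf f0 b0.
have mP t : measurable_fun setT (cauchy_pdf t b : measurableTypeR R -> R).
  exact: measurable_cauchy_pdf.
have P0 t x : 0 <= cauchy_pdf t b x by exact: cauchy_pdf_ge0.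
rewrite (@fubini_tonelli _ _ (measurableTypeR R) (measurableTypeR R) R mu leb
  (fun z => (f z.2 * cauchy_pdf z.1 b z.2)%:E))//=.
- apply: eq_integral => t _.
  under eq_integral do rewrite cauchy_pdf_sym EFinM.
  rewrite ge0_integralZl//; last 3 first.
  + by apply/measurable_EFinP; exact: mP.
  + by move=> x _; rewrite lee_fin.
  + by rewrite lee_fin.
  rewrite EFinM /Rintegral fineK//; apply: integrable_fin_num => //.
  apply: (@integrable_prob mu _ (pi * b)^-1); first exact: mP.
  by move=> x; rewrite ger0_norm ?cauchy_pdf_le.
- by apply/measurable_EFinP; exact: measurable_smoothing.
- by move=> z; rewrite lee_fin mulr_ge0.
Qed.

Lemma measurable_Rintegral_cauchy_pdf mu b : 0 < b ->
  measurable_fun setT (fun t => \int[mu]_x cauchy_pdf t b x).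
Proof.
move=> b0; apply: measurableT_comp; first exact: fine_measurable.
apply: (@measurable_fun_fubini_tonelli_F _ _ (measurableTypeR R)
  (measurableTypeR R) R mu
    (fun z => (cauchy_pdf z.1 b z.2)%:E)).
  apply/measurable_EFinP.
  have := @measurable_smoothing (cst 1) b (measurable_cst _) b0.
  by under eq_fun do rewrite mul1r.
by move=> z; rewrite lee_fin cauchy_pdf_ge0.
Qed.

Lemma Rintegral_cauchy_prob a b f : 0 < b -> measurable_fun setT f ->
  \int[cauchy_prob a b]_x f x = \int[leb]_x (f x * cauchy_pdf a b x).
Proof.
move=> b0 mf; apply: (@Rintegral_density _ _ _ leb (cauchy_prob a b)) => //.
- exact: measurable_cauchy_pdf.
- by move=> x; exact: cauchy_pdf_ge0.
- move=> A mA; have E : cauchy_prob a b A = (\int[leb]_(x in A) (cauchy_pdf a b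
  x)%:E)%E.
    by rewrite /cauchy_prob b0.
  exact: E.
Qed.

Lemma Rintegral_cauchy_prob0 a b f : b <= 0 -> measurable_fun setT f ->
  \int[cauchy_prob a b]_x f x = f a.
Proof.
move=> b0 mf; rewrite /Rintegral.
rewrite (eq_measure_integral (@dirac _ (measurableTypeR R) a R : {measure set
  (measurableTypeR R) -> \bar R})).
  rewrite integral_dirac//; last exact/measurable_EFinP.
  by rewrite diracT mul1e.
move=> A mA _; have E : cauchy_prob a b A = @dirac _ (measurableTypeR R) a R A.
  by rewrite /cauchy_prob ltNge b0.
exact: E.
Qed.

(** Widening the density from [b] to [b + y] loses at most the fraction [y / b] of it, pointwise.
    With [s] the squared distance, the difference of the two sides has the numerator
    [y (2 s + y (b + y))], which is non-negative. *)
Lemma cauchy_pdfD_ge a b y x : 0 < b -> 0 < y ->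
  cauchy_pdf a b x <= cauchy_pdf a (b + y) x + y / b * cauchy_pdf a b x.
Proof.
move=> b0 y0; have : 0 <= pi^-1 :> R by rewrite invr_ge0 pi_ge0.
rewrite /cauchy_pdf; move: pi^-1 => q q0.
rewrite [y / b * _]mulrCA -mulrDr ler_wpM2l//.
set s := (x - a) ^+ 2; have s0 : 0 <= s by exact: sqr_ge0.
have D0 : 0 < s + b ^+ 2 by rewrite ltr_wpDl// exprn_gt0.
have D1 : 0 < s + (b + y) ^+ 2 by rewrite ltr_wpDl// exprn_gt0// addr_gt0.
rewrite [y / b * _]mulrA divfK ?gt_eqF// -subr_ge0.
rewrite (_ : _ - _ = y * (2 * s + y * (b + y)) / ((s + b ^+ 2) * (s + (b + y)
  ^+ 2))).
  apply: divr_ge0; last by rewrite mulr_ge0 ?ltW.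
  apply: mulr_ge0; first exact: ltW.
  by apply: addr_ge0; [exact: mulr_ge0|rewrite mulr_ge0// ?addr_ge0// ltW].
by field; rewrite !gt_eqF.
Qed.

(** The hypotheses on the measures give information at the scale [b + y]; this brings it back to the
    scale [b]. For [b = 0] the smoothing is an approximate identity at [a], where the Lipschitz
    bound is used; for [b > 0] the pointwise comparison of densities suffices. *)
Lemma cauchy_prob_le_smoothing a b f (K k e : R) : 0 <= b ->
  measurable_fun setT f -> (forall t, 0 <= f t <= K) ->
  (forall s t, `|f s - f t| <= k * `|s - t|) -> 0 <= k -> 0 < e ->
  exists2 y0, 0 < y0 & forall y, 0 < y -> y <= y0 ->
    \int[cauchy_prob a b]_x f x <= \int[leb]_t (f t * cauchy_pdf a (b + y) t) +
      e.
Proof.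
move=> b0 mf fK fk k0 e0.
have K0 : 0 <= K by have /andP[] := fK a; exact: le_trans.
have fn t : `|f t| <= K by have /andP[? ?] := fK t; rewrite ger0_norm.
move: b0; rewrite le_eqVlt => /predU1P[<-|b0].
  rewrite Rintegral_cauchy_prob0//.
  (* Inside distance [d] the Lipschitz bound costs at most [e / 2]; the bound on [y] below makes the
     tail term [2 K y / d] at most [e / 2]. Adding 1 to [k] and to [2 K] avoids zero
     denominators. *)
  pose d := e / 2 / (k + 1).
  have d0 : 0 < d by rewrite !divr_gt0// ltr_wpDl.
  exists (e / 2 / (2 * K + 1) * d).
    by rewrite mulr_gt0// !divr_gt0// ltr_wpDl// mulr_ge0.
  move=> y y0 ye; rewrite add0r.
  have fd t : `|t - a| < d -> `|f t - f a| <= e / 2.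
    move=> td; apply: (le_trans (fk _ _)).
    apply: (@le_trans _ _ (k * d)); first by rewrite ler_wpM2l// ltW.
    rewrite /d mulrCA ler_piMr ?divr_ge0 ?(ltW e0)//.
    by rewrite ler_pdivrMr ?mul1r ?ltr_wpDl// lerDl.
  have e20 : 0 <= e / 2 by rewrite divr_ge0// ltW.
  have := poisson_approx mf fK fd d0 e20 y0.
  rewrite ler_distlC => /andP[_].
  move=> /le_trans; apply; rewrite lerD2l.
  have : 2 * K * (y / d) <= e / 2.
    apply: (@le_trans _ _ ((2 * K + 1) * (e / 2 / (2 * K + 1)))).
      apply: ler_pM; rewrite ?ler_pdivrMr// ?lerDl//.
        exact: mulr_ge0.
      by rewrite divr_ge0// ltW.
    by rewrite mulrC divfK// gt_eqF// ltr_wpDl// mulr_ge0.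
  lra.
rewrite Rintegral_cauchy_prob//.
exists (e / (K + 1) * b); first by rewrite mulr_gt0// divr_gt0// ltr_wpDl.
move=> y y0 ye.
have by0 : 0 < b + y by rewrite addr_gt0.
have iP := integrable_cauchy_pdf a b0.
have ifb := integrableM_cauchy_pdf a b0 mf fn.
have ifby := integrableM_cauchy_pdf a by0 mf fn.
apply: (@le_trans _ _ (\int[leb]_t (f t * cauchy_pdf a (b + y) t +
    K * (y / b) * cauchy_pdf a b t))).
  apply: (le_Rintegral measurableT ifb
    (RintegrableD measurableT ifby (RintegrableZl measurableT (K * (y / b))
      iP))).
  move=> t _; have /andP[f_0 f_K] := fK t.
  apply: (le_trans (ler_wpM2l f_0 (cauchy_pdfD_ge a t b0 y0))).
  rewrite mulrDr lerD2l mulrCA [K * _]mulrC -[leRHS]mulrA.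
  apply: ler_wpM2l; first by rewrite divr_ge0// ltW.
  by apply: ler_wpM2r => //; exact: cauchy_pdf_ge0.
rewrite (RintegralD measurableT ifby (RintegrableZl measurableT (K * (y / b))
  iP)).
rewrite lerD2l (RintegralZl _ measurableT iP) Rintegral_cauchy_pdf// mulr1.
apply: (@le_trans _ _ ((K + 1) * (e / (K + 1)))); last first.
  by rewrite mulrC divfK// gt_eqF// ltr_wpDl.
apply: ler_pM; rewrite ?ler_pdivrMr// ?lerDl//.
by rewrite divr_ge0// ltW.
Qed.

(** By Tonelli the left side is the [mu]-integral of the Poisson smoothing of [f], which is
    uniformly close to [f]. A modulus of continuity valid at every point is needed here, hence the
    detour through Lipschitz functions. *)
Lemma integral_smoothing_le mu f (K e d b : R) :
  measurable_fun setT f -> (forall t, 0 <= f t <= K) ->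
  (forall s t, `|t - s| < d -> `|f t - f s| <= e) ->
  0 < d -> 0 <= e -> 0 < b ->
  (\int[leb]_t (f t * \int[mu]_x cauchy_pdf t b x)%:E <=
   (\int[mu]_x f x + (e + 2 * K * (b / d)))%:E)%E.
Proof.
move=> mf fK fd d0 e0 b0.
have f_0 t : 0 <= f t by have /andP[] := fK t.
have K0 : 0 <= K by have /andP[] := fK 0; exact: le_trans.
have fn t : `|f t| <= K by have /andP[? ?] := fK t; rewrite ger0_norm.
have eta0 : 0 <= e + 2 * K * (b / d).
  by apply: addr_ge0 => //; apply: mulr_ge0;
    [exact: mulr_ge0|rewrite divr_ge0// ltW].
rewrite -tonelli_poisson//.
have smoothE x : (\int[leb]_t (f t * cauchy_pdf x b t)%:E =
    (\int[leb]_t (f t * cauchy_pdf x b t))%:E)%E.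
  rewrite /Rintegral fineK//; apply: integrable_fin_num => //.
  exact: (integrableM_cauchy_pdf x b0 mf fn).
under eq_integral do rewrite smoothE.
have iF := integrable_prob mu mf fn.
have -> : \int[mu]_x f x + (e + 2 * K * (b / d)) =
    \int[mu]_x (f x + (e + 2 * K * (b / d))).
  rewrite (RintegralD measurableT iF);
    last exact: finite_measure_integrable_cst.
  have muT : fine (mu setT) = 1 by rewrite probability_setT.
  by rewrite Rintegral_cst// [fine _]muT mulr1.
rewrite /Rintegral fineK; last first.
  apply: integrable_fin_num => //.
  by apply: RintegrableD => //; exact: finite_measure_integrable_cst.
apply: ge0_le_integral => //.
- by move=> x _; rewrite lee_fin Rintegral_ge0// => t _;
  rewrite mulr_ge0// cauchy_pdf_ge0.
- rewrite (_ : (fun x => _) = (fun x => \int[leb]_t (f t * cauchy_pdf x b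
  t)%:E)%E); last first.
    by apply/funext => x; rewrite smoothE.
  apply: (@measurable_fun_fubini_tonelli_F _ _ (measurableTypeR R)
    (measurableTypeR R) R leb
    (fun z => (f z.2 * cauchy_pdf z.1 b z.2)%:E)).
    apply/measurable_EFinP; exact: measurable_smoothing.
  by move=> z; rewrite lee_fin mulr_ge0// cauchy_pdf_ge0.
- by apply/measurable_EFinP; apply: measurable_funD.
move=> x _; rewrite lee_fin.
have := poisson_approx mf fK (fd x) d0 e0 b0.
by rewrite ler_distl => /andP[].
Qed.

(** Three comparisons are chained: from the Cauchy law to its smoothing at height [y], from there to
    the smoothings of [mu_ n] by Fatou, and back to [mu_ n] itself. The height [y] is fixed before
    [n] grows. *)
Lemma le_limit_lipschitz (mu_ : nat -> probR) a b f (K k e : R) : 0 <= b ->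
  (forall t y, 0 < y ->
    \int[mu_ n]_x cauchy_pdf t y x @[n --> \oo] --> cauchy_pdf a (b + y) t) ->
  measurable_fun setT f -> (forall t, 0 <= f t <= K) ->
  (forall s t, `|f s - f t| <= k * `|s - t|) -> 0 <= k -> 0 < e ->
  \forall n \near \oo, \int[cauchy_prob a b]_x f x <= \int[mu_ n]_x f x + e.
Proof.
move=> b0 cvg_mu mf fK fk k0 e0.
have f_0 t : 0 <= f t by have /andP[] := fK t.
have K0 : 0 <= K by have /andP[] := fK 0; exact: le_trans.
have fn t : `|f t| <= K by have /andP[? ?] := fK t; rewrite ger0_norm.
(* One quarter each for the smoothing of the limit, for Fatou, for the modulus of continuity of [f],
   and for the tail term [2 K y / d]. *)
pose e' := e / 4; have e'0 : 0 < e' by rewrite divr_gt0.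
have [y0 y00 y0P] := cauchy_prob_le_smoothing a b0 mf fK fk k0 e'0.
pose d := e' / (k + 1).
have d0 : 0 < d by rewrite divr_gt0// ltr_wpDl.
have fd s t : `|t - s| < d -> `|f t - f s| <= e'.
  move=> td; apply: (le_trans (fk _ _)).
  apply: (@le_trans _ _ (k * d)); first by rewrite ler_wpM2l// ltW.
  rewrite /d mulrCA ler_piMr ?(ltW e'0)//.
  by rewrite ler_pdivrMr ?mul1r ?ltr_wpDl// lerDl.
pose y := Num.min y0 (e' / (2 * K + 1) * d).
have y_0 : 0 < y.
  by rewrite lt_min y00 mulr_gt0// divr_gt0// ltr_wpDl// mulr_ge0.
have yK : 2 * K * (y / d) <= e'.
  apply: (@le_trans _ _ ((2 * K + 1) * (e' / (2 * K + 1)))); last first.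
    by rewrite mulrC divfK// gt_eqF// ltr_wpDl// mulr_ge0.
  apply: ler_pM; rewrite ?ler_pdivrMr// ?lerDl//.
  - exact: mulr_ge0.
  - by rewrite divr_ge0// ltW.
  - by rewrite /y ge_min lexx orbT.
have by0 : 0 < b + y by rewrite ltr_wpDl.
have : \forall n \near \oo,
    ((\int[leb]_t (f t * cauchy_pdf a (b + y) t) - e')%:E <=
    \int[leb]_t (f t * \int[mu_ n]_x cauchy_pdf t y x)%:E)%E.
  apply: fatou_eventually => //.
  - move=> n; apply: measurable_funM => //.
    exact: measurable_Rintegral_cauchy_pdf.
  - move=> n t; rewrite mulr_ge0// Rintegral_ge0// => x _.
    exact: cauchy_pdf_ge0.
  - move=> t; apply: cvgMl_tmp; exact: cvg_mu.
  - exact: (integrableM_cauchy_pdf a by0 mf fn).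
apply: filterS => n /le_trans/(_ (integral_smoothing_le (mu_ n) mf fK fd d0
  (ltW e'0) y_0)).
rewrite lee_fin.
have := y0P _ y_0; rewrite /y ge_min lexx /= => /(_ isT).
rewrite -/y; move: yK; rewrite /e'; lra.
Qed.

(** A minorant [h N] suffices because the inequality is one-sided: its integral against [mu_ n] is
    at most that of [f], and only its integral against the fixed limit law has to be close to that
    of [f]. *)
Lemma le_limit_bounded (mu_ : nat -> probR) a b f (K e : R) : 0 <= b ->
  (forall t y, 0 < y ->
    \int[mu_ n]_x cauchy_pdf t y x @[n --> \oo] --> cauchy_pdf a (b + y) t) ->
  continuous f -> (forall t, 0 <= f t <= K) -> 0 < e ->
  \forall n \near \oo, \int[cauchy_prob a b]_x f x <= \int[mu_ n]_x f x + e.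
Proof.
have arith (A B C D : R) : A - B <= e / 2 -> B <= C + e / 2 -> C <= D ->
  A <= D + e.
  by lra.
move=> b0 cvg_mu cf fK e0.
have mf : measurable_fun setT f by exact: continuous_measurable_fun.
have f_0 t : 0 <= f t by have /andP[] := fK t.
have fn t : `|f t| <= K by have /andP[? ?] := fK t; rewrite ger0_norm.
pose h (n : nat) := lipschitz_minorant f n%:R.
have h0 n x : 0 <= h n x by exact: lipschitz_minorant_ge0.
have hf n x : h n x <= f x by exact: lipschitz_minorant_le.
have hlip n s t : `|h n s - h n t| <= n%:R * `|s - t|.
  exact: lipschitz_minorant_lipschitz.
have hK n x : 0 <= h n x <= K.
  by rewrite h0 (le_trans (hf n x))//; have /andP[] := fK x.
have hn n x : `|h n x| <= K by have /andP[? ?] := hK n x; rewrite ger0_norm.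
have mh n : measurable_fun setT (h n).
  exact: continuous_measurable_fun (lipschitz_minorant_continuous f_0 (ler0n _
    n)).
have iF := integrable_prob (cauchy_prob a b) mf fn.
have [_] := @Rdominated_convergence _ _ _ (cauchy_prob a b) setT measurableT
  h f (cst K) mh (fun x _ => lipschitz_minorant_cvg f_0 (cf x))
  (finite_measure_integrable_cst _ _ measurableT) (fun n x _ => hn n x).
move=> /cvgrPdist_le /(_ (e / 2))[|N _ /(_ N (leqnn _)) /=];
  first by rewrite divr_gt0.
move=> /ler_normlW hN.
have e20 : 0 < e / 2 by rewrite divr_gt0.
have := le_limit_lipschitz b0 cvg_mu (mh N) (hK N) (hlip N) (ler0n _ N) e20.
apply: filterS => n hn_.
apply: (arith _ _ _ _ hN hn_).
apply: le_Rintegral => //; first exact: integrable_prob (mh N) (hn N).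
exact: integrable_prob mf fn.
Qed.

(** Adding the constant [K] makes both [K + f] and [K - f] non-negative and, as every measure here
    is a probability, shifts all integrals by the same amount; the two lower bounds then become a
    two-sided one. *)
Lemma weak_cvg_cauchy_prob (mu_ : nat -> probR) a b : 0 <= b ->
  (forall t y, 0 < y ->
    \int[mu_ n]_x cauchy_pdf t y x @[n --> \oo] --> cauchy_pdf a (b + y) t) ->
  weak_cvg mu_ (cauchy_prob a b).
Proof.
have arith (A B C e : R) : C + A <= C + B + e -> C - A <= C - B + e ->
  B - e <= A <= B + e.
  by move=> h1 h2; apply/andP; split; lra.
move=> b0 cvg_mu f cf bf.
have mf : measurable_fun setT f by exact: continuous_measurable_fun.
have [K [_ /(_ (K + 1))]] := bf; rewrite ltrDl ltr01 => /(_ isT) /= fK.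
have {}fK x : `|f x| <= K + 1 by exact: fK.
move: (K + 1) fK => {}K fK.
have fKle x : - K <= f x <= K by rewrite -ler_norml.
have H (mu : probR) : \int[mu]_x (K + f x) = K + \int[mu]_x f x /\
    \int[mu]_x (K - f x) = K - \int[mu]_x f x.
  have iF := integrable_prob mu mf fK.
  have iK : mu.-integrable setT (EFin \o cst K) by exact:
    finite_measure_integrable_cst.
  have muT : fine (mu setT) = 1 by rewrite probability_setT.
  split.
    by rewrite (RintegralD measurableT iK iF) Rintegral_cst// [fine _]muT mulr1.
  by rewrite (RintegralB measurableT iK iF) Rintegral_cst// [fine _]muT mulr1.
apply/cvgrPdist_le => e e0.
have H1 : \forall n \near \oo,
    \int[cauchy_prob a b]_x (K + f x) <= \int[mu_ n]_x (K + f x) + e.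
  apply: (@le_limit_bounded _ _ _ _ (K + K)) => //.
    by move=> x; apply: cvgD; [exact: cvg_cst|exact: cf].
  by move=> x; have /andP[? ?] := fKle x; apply/andP; split; lra.
have H2 : \forall n \near \oo,
    \int[cauchy_prob a b]_x (K - f x) <= \int[mu_ n]_x (K - f x) + e.
  apply: (@le_limit_bounded _ _ _ _ (K + K)) => //.
    by move=> x; apply: cvgB; [exact: cvg_cst|exact: cf].
  by move=> x; have /andP[? ?] := fKle x; apply/andP; split; lra.
move: H1 H2; apply: filterS2 => n.
have [-> ->] := H (cauchy_prob a b); have [-> ->] := H (mu_ n) => h1 h2.
by rewrite ler_distl; exact: arith h1 h2.
Qed.

End weak_convergence.

(** * Iteration of the reciprocal Cauchy transform *)

Section complex_modulus.
Context {R : realType}.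
Local Open Scope complex_scope.
Local Notation Re := complex.Re.
Local Notation Im := complex.Im.
Local Notation normc := (@Normc.normc R).
Implicit Types (z w : R[i]) (x : R).

Lemma normcD z w : normc (z + w) <= normc z + normc w.
Proof. exact: le_normcD. Qed.

Lemma normc_opp z : normc (- z) = normc z.
Proof. exact: normcN. Qed.

Lemma normcB z w : normc (z - w) <= normc z + normc w.
Proof. by rewrite -(normc_opp w); exact: normcD. Qed.

Lemma normc_distC z w : normc (z - w) = normc (w - z).
Proof. by rewrite -normc_opp opprB. Qed.

Lemma normc_ge0 z : 0 <= normc z.
Proof. by case: z => a b; exact: sqrtr_ge0. Qed.

Lemma sqr_normcE z : normc z ^+ 2 = Re z ^+ 2 + Im z ^+ 2.
Proof. by case: z => a b; rewrite sqr_sqrtr// addr_ge0 ?sqr_ge0. Qed.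

Lemma normRe_le z : `|Re z| <= normc z.
Proof.
rewrite -(@ler_sqr _ `|Re z|) ?nnegrE ?normc_ge0// real_normK ?num_real//.
by rewrite sqr_normcE lerDl sqr_ge0.
Qed.

Lemma normIm_le z : `|Im z| <= normc z.
Proof.
rewrite -(@ler_sqr _ `|Im z|) ?nnegrE ?normc_ge0// real_normK ?num_real//.
by rewrite sqr_normcE lerDr sqr_ge0.
Qed.

Lemma normc_le_ReIm z : normc z <= `|Re z| + `|Im z|.
Proof.
rewrite -(@ler_sqr _ (normc z)) ?nnegrE ?normc_ge0 ?addr_ge0//.
rewrite sqr_normcE sqrrD !real_normK ?num_real//.
by rewrite lerD2r lerDl mulrn_wge0// mulr_ge0.
Qed.

Lemma normc_real x : normc x%:C = `|x|.
Proof. by rewrite /= expr0n addr0 sqrtr_sqr. Qed.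

Lemma normc_eq0 z : (normc z == 0) = (z == 0).
Proof.
by apply/eqP/eqP => [/Normc.eq0_normc//|->]; rewrite -[RHS](@Normc.normc0 R).
Qed.

Lemma ReD z w : Re (z + w) = Re z + Re w. Proof. by case: z w => [a b] []. Qed.
Lemma ImD z w : Im (z + w) = Im z + Im w. Proof. by case: z w => [a b] []. Qed.
Lemma ReN z : Re (- z) = - Re z. Proof. by case: z. Qed.
Lemma ImN z : Im (- z) = - Im z. Proof. by case: z. Qed.
Lemma ReM z w : Re (z * w) = Re z * Re w - Im z * Im w.
Proof. by case: z w => [a b] []. Qed.
Lemma ImM z w : Im (z * w) = Re z * Im w + Im z * Re w.
Proof. by case: z w => [a b] []. Qed.
Lemma ImV z : Im z^-1 = - Im z / (Re z ^+ 2 + Im z ^+ 2).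
Proof. by rewrite mulNr; case: z. Qed.

End complex_modulus.

Section iteration.
Context {R : realType}.
Local Open Scope complex_scope.
Local Notation Re := complex.Re.
Local Notation Im := complex.Im.
Local Notation normc := (@Normc.normc R).
Local Notation probR := (probability (measurableTypeR R) R).
Implicit Types (mu : probR) (z w m : R[i]).

(* [F_mu w = w - m + o(1)] as [w] tends to infinity non-tangentially in the
   lower half-plane. *)
Definition F_asymptotics mu m := forall K e : R, 0 < e -> exists2 C : R, 0 < C &
  forall w, C <= - Im w -> `|Re w| <= K * - Im w ->
    normc (F_transform mu w - (w - m)) <= e.

(** With [d = w^2 G(w) - w] one has [F(w) = w^2 / (w + d) = w - d + d^2 / (w + d)]. Since [d] is
    close to [m], hence bounded, the last term vanishes at infinity. *)
Lemma F_asymptotics_of_cauchy_transform mu m :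
  (forall K e : R, 0 < e -> exists2 C : R, 0 < C &
    forall w, C <= - Im w -> `|Re w| <= K * - Im w ->
      normc (w ^+ 2 * cauchy_transform mu w - w - m) <= e) ->
  F_asymptotics mu m.
Proof.
(* The cap at 1 gives the bound [M = |m| + 1] on [|d|]. *)
move=> H K e e0; pose e' := Num.min (e / 2) 1.
have e'0 : 0 < e' by rewrite lt_min ltr01 divr_gt0.
have [C C0 HC] := H K e' e'0.
pose M := normc m + 1; have M0 : 0 < M by rewrite ltr_wpDl// normc_ge0.
(* The second threshold yields [|w + d| >= |w| - M >= M^2 / (e / 2)], so that [d^2 / (w + d)] is at
   most [e / 2] and [w + d] is nonzero. *)
exists (Num.max C (M + M ^+ 2 / (e / 2))).
  by rewrite lt_max C0.
move=> w; rewrite ge_max => /andP[Cw Mw] Kw.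
have := HC w Cw Kw.
set d := w ^+ 2 * _ - w => dm.
have dM : normc d <= M.
  rewrite -(subrK m d) (le_trans (normcD _ _))// addrC lerD2l (le_trans dm)//.
  by rewrite /e' ge_min lexx orbT.
have wM : M + M ^+ 2 / (e / 2) <= normc w.
  apply: (le_trans Mw); apply: le_trans (normIm_le w); rewrite -normrN.
  exact: ler_norm.
have wd : M ^+ 2 / (e / 2) <= normc (w + d).
  have : normc w <= normc (w + d) + normc d.
    by rewrite -{1}(addrK d w); exact: normcB.
  by move: wM dM; lra.
have Me0 : 0 < M ^+ 2 / (e / 2) by rewrite !divr_gt0// exprn_gt0.
have wd0 : w + d != 0.
  by rewrite -normc_eq0 gt_eqF// (lt_le_trans Me0).
have w0 : w != 0.
  by rewrite -normc_eq0 gt_eqF// (lt_le_trans _ wM)// addr_gt0.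
have GE : cauchy_transform mu w = (w + d) / w ^+ 2.
  rewrite /d addrC subrK mulrC mulKf// expf_neq0//.
have -> : F_transform mu w - (w - m) = m - d + d ^+ 2 / (w + d).
  by rewrite /F_transform GE invf_div; field.
apply: (le_trans (normcD _ _)).
have : normc (m - d) <= e / 2.
  by rewrite normc_distC (le_trans dm)// /e' ge_min lexx.
have : normc (d ^+ 2 / (w + d)) <= e / 2.
  rewrite Normc.normcM Normc.normcV expr2 Normc.normcM -expr2.
  rewrite ler_pdivrMr ?(lt_le_trans Me0)//.
  apply: (@le_trans _ _ (M ^+ 2)).
    by rewrite lerXn2r// nnegrE ?normc_ge0// ltW.
  by rewrite mulrC -ler_pdivrMr// divr_gt0.
lra.
Qed.

Lemma ReV_subr (u v x : R) :
  Re ((u +i* v - x%:C)^-1) = (u - x) / ((u - x) ^+ 2 + v ^+ 2).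
Proof. by rewrite /= subr0. Qed.

Lemma ImV_subr (u v x : R) :
  Im ((u +i* v - x%:C)^-1) = - v / ((u - x) ^+ 2 + v ^+ 2).
Proof. by rewrite /= subr0 mulNr. Qed.

Lemma continuous_ReV_subr z : Im z < 0 ->
  continuous (fun x : R => Re ((z - x%:C)^-1)).
Proof.
case: z => u v /= v0.
have -> : (fun x : R => Re ((u +i* v - x%:C)^-1)) =
    (fun x => (u - x) / ((u - x) ^+ 2 + v ^+ 2)).
  by apply/funext => x; exact: ReV_subr.
move=> x; have cu : (fun y : R => u - y) y @[y --> x] --> u - x.
  by apply: cvgB; [exact: cvg_cst|exact: cvg_id].
apply: cvgM => //; apply: cvgV.
  by rewrite gt_eqF// ltr_wpDl ?sqr_ge0// exprn_even_gt0//= lt_eqF.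
apply: cvgD; last exact: cvg_cst.
by rewrite expr2; under eq_fun do rewrite expr2; exact: cvgM.
Qed.

Lemma continuous_ImV_subr z : Im z < 0 ->
  continuous (fun x : R => Im ((z - x%:C)^-1)).
Proof.
case: z => u v /= v0.
have -> : (fun x : R => Im ((u +i* v - x%:C)^-1)) =
    (fun x => - v / ((u - x) ^+ 2 + v ^+ 2)).
  by apply/funext => x; exact: ImV_subr.
move=> x; have cu : (fun y : R => u - y) y @[y --> x] --> u - x.
  by apply: cvgB; [exact: cvg_cst|exact: cvg_id].
apply: cvgM; first exact: cvg_cst.
apply: cvgV.
  by rewrite gt_eqF// ltr_wpDl ?sqr_ge0// exprn_even_gt0//= lt_eqF.
apply: cvgD; last exact: cvg_cst.
by rewrite expr2; under eq_fun do rewrite expr2; exact: cvgM.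
Qed.

Lemma normcV_subr_le z (x : R) : Im z < 0 -> normc (z - x%:C)^-1 <= (- Im z)^-1.
Proof.
move=> z0; rewrite Normc.normcV lef_pV2 ?posrE ?oppr_gt0//; last first.
  apply: (lt_le_trans _ (normIm_le _)).
  by rewrite ImD ImN /= subr0 normr_gt0 lt_eqF.
apply: le_trans (normIm_le _).
by rewrite ImD ImN /= subr0 -normrN ler_norm.
Qed.

Lemma cauchy_transform_dilation mu (c : R) z : 0 < c -> Im z < 0 ->
  cauchy_transform (dilation c mu) z = (c^-1)%:C * cauchy_transform mu
    ((c^-1)%:C * z).
Proof.
move=> c0 z0.
have c1 : c%:C != 0 by rewrite -normc_eq0 normc_real normr_eq0 gt_eqF.
have bRe : bounded_fun (fun x : R => Re ((z - x%:C)^-1)).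
  exists (- Im z)^-1; split; first exact: num_real.
  move=> M HM x _ /=; apply: (le_trans (normRe_le _)).
  by apply: le_trans (ltW HM); exact: normcV_subr_le.
have bIm : bounded_fun (fun x : R => Im ((z - x%:C)^-1)).
  exists (- Im z)^-1; split; first exact: num_real.
  move=> M HM x _ /=; apply: (le_trans (normIm_le _)).
  by apply: le_trans (ltW HM); exact: normcV_subr_le.
have E (x : R) : (z - (c * x)%:C)^-1 = (c^-1)%:C * ((c^-1)%:C * z - x%:C)^-1.
  have -> : z - (c * x)%:C = c%:C * ((c^-1)%:C * z - x%:C).
    by rewrite mulrBr mulrA -!rmorphM /= divff ?gt_eqF// mul1r.
  by rewrite invfM fmorphV.
have w0 : Im ((c^-1)%:C * z) < 0 by rewrite ImM /= mul0r addr0 pmulr_rlt0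
  ?invr_gt0.
rewrite /cauchy_transform /Cintegral.
rewrite (dilationE c mu (continuous_ReV_subr z0) bRe).
rewrite (dilationE c mu (continuous_ImV_subr z0) bIm).
have intRe : mu.-integrable setT (EFin \o (fun x => Re (((c^-1)%:C * z -
  x%:C)^-1))).
  apply: (@integrable_prob _ mu _ (- Im ((c^-1)%:C * z))^-1).
    exact: continuous_measurable_fun (continuous_ReV_subr w0).
  by move=> x; apply: (le_trans (normRe_le _)); exact: normcV_subr_le.
have intIm : mu.-integrable setT (EFin \o (fun x => Im (((c^-1)%:C * z -
  x%:C)^-1))).
  apply: (@integrable_prob _ mu _ (- Im ((c^-1)%:C * z))^-1).
    exact: continuous_measurable_fun (continuous_ImV_subr w0).
  by move=> x; apply: (le_trans (normIm_le _)); exact: normcV_subr_le.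
apply/eqP; rewrite eq_complex; apply/andP; split; apply/eqP.
  rewrite ReM [Re (_ +i* _)]/= [Im (c^-1)%:C]/= mul0r subr0 [Re (c^-1)%:C]/=.
  rewrite -(RintegralZl _ measurableT intRe); apply: eq_Rintegral => x _.
  by rewrite E ReM [Im (c^-1)%:C]/= mul0r subr0.
rewrite ImM [Re ((\int[mu]_x _) +i* _)]/= [Im (c^-1)%:C]/= mul0r addr0 [Re
  (c^-1)%:C]/=.
rewrite -(RintegralZl _ measurableT intIm); apply: eq_Rintegral => x _.
by rewrite E ImM [Im (c^-1)%:C]/= mul0r addr0.
Qed.

Lemma F_transform_dilation mu (c : R) z : 0 < c -> Im z < 0 ->
  F_transform (dilation c mu) z = c%:C * F_transform mu ((c^-1)%:C * z).
Proof.
move=> c0 z0; rewrite /F_transform cauchy_transform_dilation// invfM.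
by rewrite -fmorphV /= invrK.
Qed.

(** The transform of the dilated measure is [F(N z) / N]. On the region considered, [N z] lies in
    the cone of aperture [B / y0] and [- Im (N z) >= N y0], so an error [e] in the asymptotics
    becomes [e / N], uniformly in [z]. *)
Lemma F_transform_step mu m (e y0 B : R) : F_asymptotics mu m ->
  0 < e -> 0 < y0 -> \forall N \near \oo, forall z,
    y0 <= - Im z -> `|Re z| <= B ->
    normc (F_transform (dilation (N%:R^-1) mu) z - (z - (N%:R^-1)%:C * m)) <= e
      / N%:R.
Proof.
move=> Fm e0 y00; have [C C0 HC] := Fm (B / y0) e e0.
exists (Num.truncn (C / y0)).+1 => // N /= NN z zy zB.
have N0 : 0 < N%:R :> R by rewrite ltr0n (leq_trans _ NN).
have z0 : Im z < 0 by rewrite -oppr_gt0 (lt_le_trans y00).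
rewrite F_transform_dilation ?invr_gt0// invrK.
have -> : z - (N%:R^-1)%:C * m = (N%:R^-1)%:C * ((N%:R)%:C * z - m).
  by rewrite mulrBr mulrA -rmorphM /= mulVf ?gt_eqF// mul1r.
have i0 : 0 <= N%:R^-1 :> R by rewrite invr_ge0.
rewrite -mulrBr Normc.normcM normc_real (ger0_norm i0) [leRHS]mulrC ler_wpM2l//.
apply: HC.
  rewrite ImM /= mul0r addr0 -mulrN.
  apply: (@le_trans _ _ (N%:R * y0)); last by rewrite ler_wpM2l// ltW.
  rewrite -ler_pdivrMr//; apply: (@le_trans _ _ (Num.truncn (C / y0)).+1%:R).
    by rewrite ltW// truncnS_gt.
  by rewrite ler_nat.
rewrite ReM ImM /= !mul0r addr0 subr0 -mulrN normrM ger0_norm ?(ltW N0)//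
  mulrCA ler_wpM2l ?(ltW N0)//.
apply: (le_trans zB); rewrite -mulrA ler_peMr ?(le_trans _ zB)//.
by rewrite ler_pdivlMl// mulr1.
Qed.

(** A new factor of the power acts innermost, so [z] is moved once by the transform of [nu] and the
    induction hypothesis is applied at the image. One step lowers [- Im z] by at most [d], because
    [Im s >= 0], and raises [|Re z|] by at most [|s| + d]; the hypotheses on [z] reserve this for
    [k] steps. Errors add up without amplification, as each stage is compared with an exact
    translation. *)
Lemma F_transform_iter (nu : probR) (s : R[i]) (d y0 B : R) :
  0 < y0 -> 0 <= d -> 0 <= Im s ->
  (forall z, y0 <= - Im z -> `|Re z| <= B ->
    normc (F_transform nu z - (z - s)) <= d) ->
  forall k rho, is_monotone_power nu k rho ->
  forall z, y0 + k%:R * d <= - Im z -> `|Re z| <= B - k%:R * (normc s + d) ->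
    normc (F_transform rho z - (z - (k%:R)%:C * s)) <= k%:R * d.
Proof.
move=> y00 d0 s0 step k rho; elim=> [|{}k {}rho nu' _ IH conv] z zy zB.
  rewrite rmorph1 !mul1r; apply: step.
    by rewrite (le_trans _ zy)// mul1r lerDl.
  by rewrite (le_trans zB)// mul1r gerBl addr_ge0// normc_ge0.
have z0 : Im z < 0.
  by rewrite -oppr_gt0 (lt_le_trans _ zy)// ltr_wpDr// mulr_ge0.
have kd0 : 0 <= k%:R * d by exact: mulr_ge0.
have ks0 : 0 <= k%:R * (normc s + d) by rewrite mulr_ge0// addr_ge0// normc_ge0.
have sd0 := normc_ge0 s.
rewrite conv//; set z' := F_transform nu z.
have zz' : normc (z' - (z - s)) <= d.
  apply: step; move: zy zB; rewrite -natr1 !mulrDl !mul1r; lra.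
have Im' := le_trans (normIm_le _) zz'.
have Re' := le_trans (normRe_le _) zz'.
have IH' : normc (F_transform rho z' - (z' - (k%:R)%:C * s)) <= k%:R * d.
  apply: IH.
    move: zy Im'; rewrite !(ImD,
      ImN) -natr1 mulrDl mul1r ler_norml => ? /andP[? ?].
    lra.
  have Rs := normRe_le s.
  have : `|Re z'| <= `|Re (z' - (z - s))| + (`|Re z| + `|Re s|).
    rewrite [Re z'](_ : _ = Re (z' - (z - s)) + (Re z - Re s)); last first.
      by rewrite !ReD !ReN ReD ReN; ring.
    by rewrite (le_trans (ler_normD _ _))// lerD2l ler_normB.
  by move: zB; rewrite -natr1 mulrDl mul1r; lra.
have -> : F_transform rho z' - (z - (k.+1%:R)%:C * s) =
    F_transform rho z' - (z' - (k%:R)%:C * s) + (z' - (z - s)).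
  by rewrite -natr1 rmorphD /= rmorph1; ring.
rewrite (le_trans (normcD _ _))//.
by rewrite -natr1 mulrDl mul1r lerD.
Qed.

Lemma F_transform_monotone_limit mu m (muM : nat -> probR) (z : R[i]) (e : R) :
  F_asymptotics mu m -> 0 <= Im m ->
  (forall N : nat, (0 < N)%N ->
    is_monotone_power (dilation (N%:R^-1) mu) N (muM N)) ->
  Im z < 0 -> 0 < e ->
  \forall N \near \oo, normc (F_transform (muM N) z - (z - m)) <= e.
Proof.
move=> Fm m0 muME z0 e0.
(* Half of the height of [z] is left as a margin. With [d <= y0] the [N] steps, each with error
   [d / N], use at most the other half, and the bound on the real part, [|Re z| + |m| + d], is
   exactly what they need. *)
pose y0 := - Im z / 2; have y00 : 0 < y0 by rewrite divr_gt0// oppr_gt0.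
pose d := Num.min e y0; have d0 : 0 < d by rewrite lt_min e0.
have := F_transform_step (`|Re z| + (normc m + d)) Fm d0 y00.
apply: filterS2 (nbhs_infty_gt 0) => N N0 step.
have NR0 : 0 < N%:R :> R by rewrite ltr0n.
have Nd : N%:R * (d / N%:R) = d by rewrite mulrC divfK// gt_eqF.
have Nm : (N%:R)%:C * ((N%:R^-1)%:C * m) = m.
  by rewrite mulrA -rmorphM /= divff ?gt_eqF// mul1r.
have im0 : 0 <= Im ((N%:R^-1)%:C * m).
  by rewrite ImM /= mul0r addr0 mulr_ge0 ?invr_ge0.
have dN0 : 0 <= d / N%:R by rewrite divr_ge0 ?ltW.
have := F_transform_iter y00 dN0 im0 step (muME N N0) (z := z).
rewrite Nd Nm => H; apply: (@le_trans _ _ d); last by rewrite /d ge_min lexx.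
apply: H.
  have : d <= y0 by rewrite /d ge_min lexx orbT.
  by rewrite /y0; lra.
have i0 : 0 <= N%:R^-1 :> R by rewrite invr_ge0.
rewrite mulrDr Nd Normc.normcM normc_real (ger0_norm i0).
by rewrite mulrA divff ?gt_eqF// mul1r addrK.
Qed.

(** At [z = t - i y] the imaginary part of [1 / (z - x)] is [pi] times the Cauchy density, so the
    integral is [Im G(z) / pi] with [G = 1 / F]. The limit [z - m] of [F] is nonzero because
    [Im (z - m) <= - y < 0]. *)
Lemma poisson_monotone_limit mu m (muM : nat -> probR) (t y : R) :
  F_asymptotics mu m -> 0 <= Im m ->
  (forall N : nat, (0 < N)%N ->
    is_monotone_power (dilation (N%:R^-1) mu) N (muM N)) ->
  0 < y ->
  \int[muM n]_x cauchy_pdf t y x @[n --> \oo] --> cauchy_pdf (Re m) (Im m + y)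
    t.
Proof.
move=> Fm m0 muME y0.
pose z : R[i] := t -i* y.
have z0 : Im z < 0 by rewrite /= oppr_lt0.
have PE (nu : probR) : \int[nu]_x cauchy_pdf t y x = pi^-1 * Im
  (cauchy_transform nu z).
  rewrite [Im _](_ : _ = \int[nu]_x Im ((z - x%:C)^-1))// -RintegralZl//;
    last first.
    apply: (@integrable_prob _ nu _ (- Im z)^-1).
      exact: continuous_measurable_fun (continuous_ImV_subr z0).
    by move=> x; apply: (le_trans (normIm_le _)); exact: normcV_subr_le.
  apply: eq_Rintegral => x _.
  by rewrite ImV_subr /cauchy_pdf opprK sqrrN -[in LHS]sqrrN opprB.
rewrite (funext (fun n => PE (muM n))).
have -> : cauchy_pdf (Re m) (Im m + y) t =
    pi^-1 * (- (Im (z - m)) / (Re (z - m) ^+ 2 + Im (z - m) ^+ 2)).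
  rewrite /cauchy_pdf !(ReD, ImD, ReN, ImN) /=.
  by rewrite -opprD sqrrN opprK [y + _]addrC.
apply: cvgMl_tmp.
rewrite (_ : (fun n => _) = (fun n => - Im (F_transform (muM n) z) /
   (Re (F_transform (muM n) z) ^+ 2 + Im (F_transform (muM n) z) ^+ 2)));
     last first.
  by apply/funext => n; rewrite -ImV /F_transform invrK.
have cRe : Re (F_transform (muM n) z) @[n --> \oo] --> Re (z - m).
  apply/cvgrPdist_le => e e0.
  apply: filterS (F_transform_monotone_limit Fm m0 muME z0 e0) => n.
  apply: le_trans; rewrite normc_distC -ReN -ReD; exact: normRe_le.
have cIm : Im (F_transform (muM n) z) @[n --> \oo] --> Im (z - m).
  apply/cvgrPdist_le => e e0.
  apply: filterS (F_transform_monotone_limit Fm m0 muME z0 e0) => n.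
  apply: le_trans; rewrite normc_distC -ImN -ImD; exact: normIm_le.
apply: cvgM; first exact: cvgN.
apply: cvgV.
  rewrite gt_eqF// ltr_wpDl ?sqr_ge0// exprn_even_gt0//= ImD ImN /=.
  by rewrite -opprD oppr_eq0 gt_eqF// ltr_pwDl.
apply: cvgD; rewrite expr2; under eq_fun do rewrite expr2; exact: cvgM.
Qed.

End iteration.

(** * Integrals over the exterior of an interval *)

Section exterior_integral.
Context {R : realType}.
Local Notation leb := (@lebesgue_measure R : {measure set (measurableTypeR R)
  -> \bar R}).
Implicit Types (g H : R -> R) (r x : R).

Definition exterior r : set (measurableTypeR R) := [set x | r <= `|x|].

Lemma measurable_exterior r : measurable (exterior r).
Proof.
rewrite (_ : exterior r = (fun x : R => `|x|) @^-1` `[r, +oo[); last first.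
  by apply/seteqP; split => x; rewrite /exterior /= in_itv/= andbT.
rewrite -[X in measurable X]setTI; apply: normr_measurable => //.
Qed.

Lemma indic_exterior1 r x : r <= `|x| -> \1_(exterior r) x = 1 :> R.
Proof. by move=> rx; rewrite indicE mem_set. Qed.

Lemma indic_exterior0 r x : `|x| < r -> \1_(exterior r) x = 0 :> R.
Proof.
move=> rx; rewrite indicE memNset// /exterior /= => H.
by move: rx; rewrite ltNge H.
Qed.

Lemma FTC2_exterior g H r (a b : R) : 0 < r ->
  (forall x, r <= `|x| -> is_derive x 1 H (g x)) ->
  (forall x, r <= `|x| -> {for x, continuous g}) ->
  a < b -> (forall x, a <= x <= b -> r <= `|x|) ->
  \int[leb]_(x in `[a, b]) g x = H b - H a.
Proof.
move=> r0 dH cg ab abr; rewrite /Rintegral (@continuous_FTC2 _ g H a b ab)//.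
- apply: continuous_in_subspaceT => x; rewrite inE /= in_itv /= => xab.
  by apply: cg; exact: abr.
- have cH x : a <= x <= b -> {for x, continuous H}.
    move=> /abr/dH dHx; apply: differentiable_continuous.
    by rewrite -derivable1_diffP; exact: ex_derive.
  split.
  + move=> x; rewrite in_itv /= => /andP[ax xb].
    by have := dH x (abr x _); rewrite !ltW// => /(_ isT) dHx; exact: ex_derive.
  + by apply: cvg_at_right_filter; apply: cH; rewrite lexx ltW.
  + by apply: cvg_at_left_filter; apply: cH; rewrite lexx ltW.
- move=> x; rewrite in_itv /= => /andP[ax xb].
  have := dH x (abr x _); rewrite !ltW// => /(_ isT) dHx.
  by rewrite derive1E; exact: derive_val.
Qed.

(** Integrability lets dominated convergence replace the integral by its truncations to [[r, n]] and
    [[-n, -r]], disjoint since [r > 0]. Truncating symmetrically means that only the difference of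
    the two values of the primitive must converge, so growing even terms such as [ln (x^2)]
    cancel. *)
Lemma Rintegral_exterior g H r (L : R) : 0 < r ->
  (forall x, r <= `|x| -> is_derive x 1 H (g x)) ->
  (forall x, r <= `|x| -> {for x, continuous g}) ->
  leb.-integrable setT (EFin \o (fun x => \1_(exterior r) x * g x)) ->
  H n%:R - H (- n%:R) @[n --> \oo] --> L ->
  \int[leb]_x (\1_(exterior r) x * g x) = L + H (- r) - H r.
Proof.
move=> r0 dH cg ig HL.
pose S x : R := \1_(exterior r) x.
pose i1 (n : nat) x : R := \1_(`[r, n%:R] : set (measurableTypeR R)) x.
pose i2 (n : nat) x : R := \1_(`[- n%:R, - r] : set (measurableTypeR R)) x.
have iE (a b x : R) : \1_(`[a,
  b] : set (measurableTypeR R)) x = ((a <= x <= b)%R)%:R :> R.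
  rewrite indicE; congr (nat_of_bool _)%:R.
  by apply/idP/idP; rewrite inE /= in_itv.
have i1S n x : i1 n x * (S x * g x) = i1 n x * g x.
  rewrite /i1 iE; have [/andP[rx _]|_] := boolP (r <= x <= n%:R);
    last by rewrite !mul0r.
  by rewrite !mul1r /S indic_exterior1 ?mul1r// (le_trans rx)// ler_norm.
have i2S n x : i2 n x * (S x * g x) = i2 n x * g x.
  rewrite /i2 iE; have [/andP[_ rx]|_] := boolP (- n%:R <= x <= - r);
    last by rewrite !mul0r.
  by rewrite !mul1r /S indic_exterior1 ?mul1r// -normrN (le_trans _ (ler_norm
    _))// lerNr.
have mg : measurable_fun setT (fun x => S x * g x).
  by apply/measurable_EFinP; exact: measurable_int ig.
have le_i x (n : nat) : 0 <= i1 n x + i2 n x <= 1.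
  rewrite /i1 /i2 !iE; have [/andP[rx _]|_] := boolP (r <= x <= n%:R).
    have [/andP[_ xr]|_] := boolP (- n%:R <= x <= - r);
      last by rewrite addr0 ler01 lexx.
    by exfalso; lra.
  by rewrite add0r; have [_|_] := boolP (- n%:R <= x <= - r);
    rewrite ?lexx ?ler01.
have mi (a b : R) : measurable_fun setT (\1_(`[a,
  b] : set (measurableTypeR R)) : _ -> R).
  exact: measurable_indic.
have ig' : leb.-integrable setT (EFin \o (fun x => `|S x * g x|)) by exact:
  integrable_norm ig.
have cvg1 : \int[leb]_x ((i1 n x + i2 n x) * (S x * g x)) @[n --> \oo] -->
    \int[leb]_x (S x * g x).
  apply: (Rdominated_convergence _ _ _ ig' _).2 => //.
  - by move=> n; apply: measurable_funM => //; apply: measurable_funD;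
    exact: mi.
  - move=> x _; apply: (@cvg_trans _ ((S x * g x) @[n --> \oo]));
    last exact: cvg_cst.
    apply: near_eq_cvg; near=> n.
    have xn : `|x| <= n%:R by near: n; exact: nbhs_infty_ger.
    have [rx|rx] := leP r `|x|;
      last by rewrite /S indic_exterior0// mul0r mulr0.
    rewrite [i1 n x + i2 n x](_ : _ = 1) ?mul1r//.
    rewrite /i1 /i2 !iE; move: rx xn; have [x0|x0] := ger0P x => rx xn.
      rewrite rx xn (_ : (- n%:R <= x <= - r) = false) ?addr0//.
      by apply/negbTE/negP => /andP[_]; lra.
    rewrite (_ : (r <= x <= n%:R) = false) ?add0r.
      by have -> : (- n%:R <= x <= - r) = true by apply/andP; split; lra.
    by apply/negbTE/negP => /andP[? _]; lra.
  - move=> n x _; rewrite normrM ler_piMl//.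
    by have /andP[h0 h1] := le_i x n; rewrite ger0_norm.
apply: (cvg_unique _ cvg1) => //.
apply: (@cvg_trans _ ((H n%:R - H (- n%:R) + H (- r) - H r) @[n --> \oo]));
  last first.
  by apply: cvgB; [apply: cvgD => //; exact: cvg_cst|exact: cvg_cst].
apply: near_eq_cvg; near=> n.
have rn : r < n%:R by near: n; exact: nbhs_infty_gtr.
have intM (a b : R) : (forall x, a <= x <= b -> r <= `|x|) ->
   leb.-integrable setT (EFin \o (fun x => \1_(`[a,
     b] : set (measurableTypeR R)) x * g x)).
  move=> abr; apply: (le_Rintegrable measurableT _ _ ig').
    rewrite (_ : (fun x => _) = (fun x => \1_(`[a,
      b] : set (measurableTypeR R)) x * (S x * g x))).
      by apply: measurable_funM => //; exact: mi.
    apply/funext => x; rewrite iE; have [/abr rx|_] := boolP (a <= x <= b);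
      last by rewrite !mul0r.
    by rewrite /S indic_exterior1 ?mul1r.
  move=> x _; rewrite iE; have [/abr rx|_] := boolP (a <= x <= b).
    by rewrite /S indic_exterior1 ?mul1r.
  by rewrite mul0r normr0.
have intE (a b : R) : a < b -> (forall x, a <= x <= b -> r <= `|x|) ->
    \int[leb]_x (\1_(`[a, b] : set (measurableTypeR R)) x * g x) = H b - H a.
  move=> ab abr; rewrite -(FTC2_exterior r0 dH cg ab abr) [RHS]Rintegral_mkcond.
  apply: eq_Rintegral => x _; rewrite patchE iE mem_setE.
  rewrite (_ : (x \in `[a, b]) = (a <= x <= b)) ?in_itv//.
  by case: ifP => _; rewrite ?mul1r ?mul0r.
have h1 x : r <= x <= n%:R -> r <= `|x|.
  by move=> /andP[rx _]; rewrite (le_trans rx)// ler_norm.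
have h2 x : - n%:R <= x <= - r -> r <= `|x|.
  by move=> /andP[_ rx]; rewrite -normrN (le_trans _ (ler_norm _))// lerNr.
under eq_Rintegral do rewrite mulrDl i1S i2S.
rewrite (RintegralD measurableT (intM _ _ h1) (intM _ _ h2)).
rewrite (intE _ _ rn h1) intE ?ltrN2//.
ring.
Unshelve. all: by end_near. Qed.

End exterior_integral.

(** * The kernels [x / (w - x)] and [1 / x + 1 / (w - x)] *)

Section nontangential_kernel.
Context {R : realType}.
Local Open Scope complex_scope.
Local Notation Re := complex.Re.
Local Notation Im := complex.Im.
Local Notation normc := (@Normc.normc R).
Local Notation leb := (@lebesgue_measure R : {measure set (measurableTypeR R)
  -> \bar R}).
Implicit Types (w : R[i]) (u c r x : R).

Lemma ler_dist_ln (A B m : R) : 0 < m -> m <= A -> m <= B ->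
  `|ln A - ln B| <= `|A - B| / m.
Proof.
move=> m0; suff H (X Y : R) : m <= X -> m <= Y -> ln X - ln Y <= `|X - Y| / m.
  move=> mA mB; rewrite ler_norml H// andbT lerNl opprB distrC; exact: H.
move=> mX mY; have X0 := lt_le_trans m0 mX; have Y0 := lt_le_trans m0 mY.
rewrite -ln_div ?posrE//.
rewrite (_ : X / Y = 1 + (X - Y) / Y); last by field; rewrite gt_eqF.
apply: (@le_trans _ _ ((X - Y) / Y)).
  by apply: le_ln1Dx; rewrite ltr_pdivlMr// mulN1r ltrBrDl subrr.
apply: (@le_trans _ _ (`|X - Y| / Y));
  first by rewrite ler_pM2r ?invr_gt0// ler_norm.
by rewrite ler_wpM2l// lef_pV2.
Qed.

Lemma measurable_invr : measurable_fun setT (fun x : measurableTypeR R => x^-1).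
Proof.
(* Inversion is discontinuous at 0, so it is written through a measurable power of [x^2]; at 0 both
   sides are 0. *)
rewrite (_ : (fun x => _) = (fun x : R => x * (x ^+ 2) `^ (- 1))); last first.
  apply/funext => x; rewrite powR_inv1 ?sqr_ge0// expr2 invfM mulrA.
  by have [->|x0] := eqVneq x 0; rewrite ?mul0r ?invr0 ?divff ?mul1r.
apply: measurable_funM => //.
have mp : measurable_fun setT (fun y : measurableTypeR R => y `^ (- 1) :
  measurableTypeR R).
  exact: measurable_powR.
by apply: (measurableT_comp mp); exact: exprn_measurable.
Qed.

(** For [|x| >= r], [x^-2] is at most [(1 + r^-2) / (1 + x^2)], a multiple of the standard Cauchy
    density. *)
Lemma integrable_exterior_inv2 r : 0 < r ->
  leb.-integrable setT (EFin \o (fun x => \1_(exterior r) x * (x ^+ 2)^-1)).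
Proof.
move=> r0; apply: (le_Rintegrable measurableT _ _
  (RintegrableZl measurableT (pi * (1 + (r ^+ 2)^-1)) (integrable_cauchy_pdf 0
    (@ltr01 R)))).
  apply: measurable_funM; first by apply: measurable_indic;
    exact: measurable_exterior.
  apply: (measurableT_comp measurable_invr); exact: exprn_measurable.
move=> x _; have [rx|rx] := leP r `|x|; last first.
  rewrite indic_exterior0// mul0r normr0 mulr_ge0 ?cauchy_pdf_ge0//.
  by rewrite mulr_ge0 ?pi_ge0// addr_ge0// invr_ge0 sqr_ge0.
rewrite indic_exterior1// mul1r /cauchy_pdf subr0 expr1n.
have r20 : 0 < r ^+ 2 by rewrite exprn_gt0.
have rx2 : r ^+ 2 <= x ^+ 2.
  by rewrite -(real_normK (num_real x)) lerXn2r// nnegrE ltW.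
have x20 := lt_le_trans r20 rx2.
rewrite ger0_norm; last by rewrite invr_ge0 ltW.
have := pi_gt0 R; move: pi => p p0.
have -> : p * (1 + (r ^+ 2)^-1) * (p^-1 * (1 / (x ^+ 2 + 1))) =
    (1 + (r ^+ 2)^-1) / (x ^+ 2 + 1).
  by field; rewrite !gt_eqF// addr_gt0.
rewrite ler_pdivlMr ?addr_gt0// mulrDr mulVf ?gt_eqF// mulr1 lerD2l.
by rewrite lef_pV2.
Qed.

(** Chosen so that [w rho = w^2 / (w - x) - w], the integrand of [w^2 G(w) - w], while also
    [w rho = x (1 + rho)]: the integrand is [x] up to a relative error [rho] that vanishes at
    infinity. *)
Definition rho w x : R[i] := x%:C / (w - x%:C).

Lemma normc_subr_ge w x : - Im w <= normc (w - x%:C).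
Proof.
by apply: le_trans (normIm_le _); rewrite ImD ImN /= subr0 -normrN ler_norm.
Qed.

(** Two bounds in one: [|x| / - Im w] gives decay for fixed [x], while [rho = w / (w - x) - 1] gives
    a bound uniform in [x]. The prefactor is bounded on cones; this is where non-tangential approach
    enters. *)
Lemma normc_rho_le w x : Im w < 0 ->
  normc (rho w x) <= (normc w / - Im w + 1) * Num.min (`|x| / - Im w) 1.
Proof.
rewrite -oppr_gt0 => c0; have wx := normc_subr_ge w x.
have wx0 : 0 < normc (w - x%:C) by exact: lt_le_trans wx.
have wx_neq0 : w - x%:C != 0 by rewrite -normc_eq0 gt_eqF.
have h1 : normc (rho w x) <= `|x| / - Im w.
  by rewrite Normc.normcM Normc.normcV normc_real ler_wpM2l// lef_pV2.
have h2 : normc (rho w x) <= normc w / - Im w + 1.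
  rewrite (_ : rho w x = w / (w - x%:C) - 1); last by rewrite /rho; field.
  apply: (le_trans (normcB _ _)); rewrite [normc 1](@Normc.normc1 R) lerD2r.
  by rewrite Normc.normcM Normc.normcV ler_wpM2l ?normc_ge0// lef_pV2.
have K0 : 0 <= normc w / - Im w by rewrite divr_ge0 ?normc_ge0 ?ltW.
have x0 : 0 <= `|x| / - Im w by rewrite divr_ge0// ltW.
rewrite minEle; case: ifP => _; last by rewrite mulr1.
by rewrite mulrDl mul1r (le_trans h1)// lerDr mulr_ge0.
Qed.

Lemma normc_rho_le1 w x : Im w < 0 -> normc (rho w x) <= normc w / - Im w + 1.
Proof.
move=> w0; apply: (le_trans (normc_rho_le _ w0));
  rewrite ler_piMr ?ge_min ?lexx ?orbT//.
by rewrite addr_ge0// divr_ge0 ?normc_ge0// oppr_ge0 ltW.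
Qed.

(** This is [(1 + rho) / x], the factor that [a_2] meets. Each summand decays only like [1 / x], but
    the sum is [w / (x (w - x))], hence integrable on the exterior set. *)
Definition kernel w x : R[i] := (x^-1)%:C + (w - x%:C)^-1.

Lemma kernelE w x : Im w < 0 -> x != 0 -> x%:C * kernel w x = 1 + rho w x.
Proof.
move=> w0 x0; rewrite /kernel mulrDr -rmorphM /= divff//.
Qed.

Lemma normc_kernel_le w x : Im w < 0 -> x != 0 ->
  normc (kernel w x) <= normc w * (normc w / - Im w + 1) * (x ^+ 2)^-1.
Proof.
move=> w0 x0; have wx_neq0 : w - x%:C != 0.
  by rewrite -normc_eq0 gt_eqF// (lt_le_trans _ (normc_subr_ge _ _))// oppr_gt0.
have xC0 : x%:C != 0 by rewrite -normc_eq0 normc_real normr_eq0.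
have -> : kernel w x = w * rho w x * ((x ^+ 2)^-1)%:C.
  by rewrite /kernel /rho expr2 invfM rmorphM /= fmorphV /=; field;
    rewrite wx_neq0 xC0.
have i0 : 0 <= (x ^+ 2)^-1 by rewrite invr_ge0 sqr_ge0.
rewrite 2!Normc.normcM (normc_real (x ^+ 2)^-1) (ger0_norm i0) ler_wpM2r//
  ler_wpM2l ?normc_ge0//.
exact: normc_rho_le1.
Qed.

Lemma Re_kernel u c x :
  Re (kernel (u -i* c) x) = x^-1 + (u - x) / ((u - x) ^+ 2 + c ^+ 2).
Proof. by rewrite /kernel ReD ReV_subr sqrrN. Qed.

Lemma Im_kernel u c x :
  Im (kernel (u -i* c) x) = c / ((u - x) ^+ 2 + c ^+ 2).
Proof. by rewrite /kernel ImD ImV_subr sqrrN opprK add0r. Qed.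

Lemma measurable_Re_kernel w : Im w < 0 ->
  measurable_fun setT (fun x : measurableTypeR R => Re (kernel w x)).
Proof.
move=> w0; rewrite (_ : (fun x => _) = (fun x => x^-1 + Re ((w - x%:C)^-1))).
  apply: measurable_funD; first exact: measurable_invr.
  exact: continuous_measurable_fun (continuous_ReV_subr w0).
by apply/funext => x; rewrite /kernel ReD.
Qed.

Lemma measurable_Im_kernel w : Im w < 0 ->
  measurable_fun setT (fun x : measurableTypeR R => Im (kernel w x)).
Proof.
move=> w0; rewrite (_ : (fun x => _) = (fun x => Im ((w - x%:C)^-1))).
  exact: continuous_measurable_fun (continuous_ImV_subr w0).
by apply/funext => x; rewrite /kernel ImD add0r.
Qed.

Lemma exterior_kernel_le w r x : 0 < r -> Im w < 0 ->
  \1_(exterior r) x * normc (kernel w x) <=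
  normc w * (normc w / - Im w + 1) * (\1_(exterior r) x * (x ^+ 2)^-1).
Proof.
move=> r0 w0; have [rx|rx] := leP r `|x|;
  last by rewrite indic_exterior0// !mul0r mulr0.
rewrite indic_exterior1// !mul1r normc_kernel_le//.
by rewrite -normr_gt0 (lt_le_trans r0).
Qed.

Lemma indic_exterior_ge0 r x : 0 <= \1_(exterior r) x :> R.
Proof. by rewrite indicE. Qed.

Lemma integrable_exterior_Re_kernel w r : 0 < r -> Im w < 0 ->
  leb.-integrable setT (EFin \o (fun x => \1_(exterior r) x * Re (kernel w x))).
Proof.
move=> r0 w0; apply: (le_Rintegrable measurableT _ _
  (RintegrableZl measurableT (normc w * (normc w / - Im w + 1))
    (integrable_exterior_inv2 r0))).
  apply: measurable_funM; last exact: measurable_Re_kernel.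
  by apply: measurable_indic; exact: measurable_exterior.
move=> x _; apply: le_trans (exterior_kernel_le x r0 w0).
rewrite normrM (ger0_norm (indic_exterior_ge0 _ _)).
by apply: ler_wpM2l; [exact: indic_exterior_ge0|exact: normRe_le].
Qed.

Lemma integrable_exterior_Im_kernel w r : 0 < r -> Im w < 0 ->
  leb.-integrable setT (EFin \o (fun x => \1_(exterior r) x * Im (kernel w x))).
Proof.
move=> r0 w0; apply: (le_Rintegrable measurableT _ _
  (RintegrableZl measurableT (normc w * (normc w / - Im w + 1))
    (integrable_exterior_inv2 r0))).
  apply: measurable_funM; last exact: measurable_Im_kernel.
  by apply: measurable_indic; exact: measurable_exterior.
move=> x _; apply: le_trans (exterior_kernel_le x r0 w0).
rewrite normrM (ger0_norm (indic_exterior_ge0 _ _)).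
by apply: ler_wpM2l; [exact: indic_exterior_ge0|exact: normIm_le].
Qed.

(** The imaginary part is [pi] times a Cauchy density, with integral [pi] over the line. The removed
    interval has length [2 r] and the integrand is at most [1 / c] there. *)
Lemma Rintegral_exterior_Im_kernel u c r : 0 < r -> 0 < c ->
  `|\int[leb]_x (\1_(exterior r) x * Im (kernel (u -i* c) x)) - pi| <= 2 * r /
    c.
Proof.
move=> r0 c0; have w0 : Im (u -i* c) < 0 by rewrite /= oppr_lt0.
have -> : pi = \int[leb]_x (pi * cauchy_pdf u c x).
  by rewrite (RintegralZl _ measurableT (integrable_cauchy_pdf u c0))
    Rintegral_cauchy_pdf// mulr1.
pose B : set (measurableTypeR R) := `[- r, r]%classic.
have iB : leb.-integrable setT (EFin \o (fun x => c^-1 * \1_B x)).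
  apply: RintegrableZl => //.
  by have := integrable_indic_itv (- r) r true false; apply: eq_integrable.
have -> : 2 * r / c = \int[leb]_x (c^-1 * \1_B x).
  rewrite RintegralZl//; last first.
    by have := integrable_indic_itv (- r) r true false; apply: eq_integrable.
  rewrite mulrC; congr (_ * _); rewrite /Rintegral integral_indic//;
    last exact: measurable_itv.
  rewrite setIT.
  rewrite [X in fine X](@lebesgue_measure_itv R `[- r, r]) /= lte_fin;
    case: ifPn => [_|]; last by move=> /negP; case; lra.
  by rewrite /=; lra.
apply: (le_dist_Rintegral measurableT (integrable_exterior_Im_kernel r0 w0) _
  iB).
  exact: RintegrableZl (integrable_cauchy_pdf u c0).
move=> x _.
have -> : pi * cauchy_pdf u c x = Im (kernel (u -i* c) x).
  rewrite Im_kernel /cauchy_pdf mulrA divff ?gt_eqF ?pi_gt0// mul1r.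
  by rewrite -[in LHS]sqrrN opprB.
have [rx|rx] := leP r `|x|.
  rewrite indic_exterior1// mul1r subrr normr0; apply: mulr_ge0.
    by rewrite invr_ge0 ltW.
  by rewrite indicE.
rewrite indic_exterior0// mul0r sub0r normrN indicE mem_set ?mulr1; last first.
  by rewrite /B /= in_itv /= -ler_norml ltW.
rewrite Im_kernel ger0_norm;
  last by rewrite divr_ge0 ?(ltW c0)// addr_ge0 ?sqr_ge0.
have c20 : 0 < c ^+ 2 by rewrite exprn_gt0.
by rewrite ler_pdivrMr ?ltr_wpDl ?sqr_ge0// ler_pdivlMl// -expr2 lerDr sqr_ge0.
Qed.

(** Writing [ln (y^2) / 2] for [ln |y|] covers both half-lines with one formula. *)
Lemma is_derive_kernel_primitive u c x : 0 < c -> x != 0 ->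
  is_derive x 1 (fun y => ln (y ^+ 2) / 2 - ln ((u - y) ^+ 2 + c ^+ 2) / 2)
    (x^-1 + (u - x) / ((u - x) ^+ 2 + c ^+ 2)).
Proof.
move=> c0 x0.
have x20 : 0 < x ^+ 2 by rewrite exprn_even_gt0.
have D0 : 0 < (u - x) ^+ 2 + c ^+ 2 by rewrite ltr_wpDl ?sqr_ge0// exprn_gt0.
have d1 : is_derive x (1 : R) (fun y => y ^+ 2) (2 * x).
  apply: is_derive_eq; rewrite /GRing.scale /= mulr1; ring.
have d2 : is_derive x (1 : R) (fun y => (u - y) ^+ 2 + c ^+ 2) (- 2 * (u - x)).
  have -> : (fun y => (u - y) ^+ 2 + c ^+ 2) = (cst u - id) ^+ 2 + cst (c ^+ 2).
    by apply/funext => y.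
  apply: is_derive_eq; rewrite /GRing.scale /= addr0 sub0r.
  by rewrite -[(cst u - id) x]/(u - x) expr1; ring.
have e1 := @is_derive1_comp R (@ln R) (fun y => y ^+ 2) x _ _ (is_derive1_ln
  x20) d1.
have e2 := @is_derive1_comp R (@ln R) (fun y => (u - y) ^+ 2 + c ^+ 2) x _ _
  (is_derive1_ln D0) d2.
have -> : (fun y => ln (y ^+ 2) / 2 - ln ((u - y) ^+ 2 + c ^+ 2) / 2) =
    (2^-1 \*: (@ln R \o (fun y => y ^+ 2)) - 2^-1 \*: (@ln R \o (fun y => (u -
      y) ^+ 2 + c ^+ 2))).
  by apply/funext => y /=; rewrite [in LHS]mulrC [X in _ - X = _]mulrC.
apply: is_derive_eq; rewrite /GRing.scale /=; field.
by rewrite gt_eqF.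
Qed.

Lemma kernel_primitive_cvg u c : 0 < c ->
  (ln ((u + n%:R) ^+ 2 + c ^+ 2) - ln ((u - n%:R) ^+ 2 + c ^+ 2)) / 2 @[n -->
    \oo]
  --> (0 : R).
Proof.
move=> c0.
apply/cvgr0Pnorm_le => e e0; near=> n.
(* The two arguments of the logarithm differ by [4 u n] and, once [n >= 2 |u|], both are at least
   [n^2 / 4]. Half the difference of the logarithms is then at most [8 |u| / n]. *)
have n1 : 1 <= n%:R :> R by near: n; exact: nbhs_infty_ger.
have nu : 2 * `|u| <= n%:R by near: n; exact: nbhs_infty_ger.
have ne : 8 * `|u| / e <= n%:R by near: n; exact: nbhs_infty_ger.
move: (n%:R : R) n1 nu ne => y y1 yu ye.
have y0 : 0 < y by lra.
have /andP[u1 u2] : - `|u| <= u <= `|u| by rewrite -ler_norml.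
have c20 : 0 < c ^+ 2 by rewrite exprn_gt0.
have y20 : 0 < y ^+ 2 / 4 by rewrite divr_gt0// exprn_gt0.
have A1 : y ^+ 2 / 4 <= (u + y) ^+ 2 + c ^+ 2.
  apply: (@le_trans _ _ ((u + y) ^+ 2)); last by rewrite lerDl ltW.
  rewrite (_ : y ^+ 2 / 4 = (y / 2) ^+ 2); last by field.
  by apply: lerXn2r; rewrite ?nnegrE; lra.
have A2 : y ^+ 2 / 4 <= (u - y) ^+ 2 + c ^+ 2.
  apply: (@le_trans _ _ ((u - y) ^+ 2)); last by rewrite lerDl ltW.
  rewrite (_ : y ^+ 2 / 4 = (y / 2) ^+ 2); last by field.
  by rewrite -[leRHS]sqrrN opprB; apply: lerXn2r; rewrite ?nnegrE; lra.
rewrite normrM [`|2^-1|]ger0_norm// ler_pdivrMr//.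
apply: (le_trans (ler_dist_ln y20 A1 A2)).
rewrite (_ : _ - _ = 4 * u * y); last by ring.
rewrite ler_pdivrMr// !normrM [`|4|]ger0_norm// [`|y|]gtr0_norm//.
rewrite (_ : e * 2 * (y ^+ 2 / 4) = (e * y / 2) * y); last by field.
rewrite ler_pM2r//.
move: ye; rewrite ler_pdivrMr//; lra.
Unshelve. all: by end_near. Qed.

(** The terms [ln (r^2)] cancel between [r] and [- r]. What remains is half a difference of
    logarithms whose arguments are at least [c^2] and differ by [4 u r]. In a cone [|u| <= K c] this
    is O(1 / c). *)
Lemma Rintegral_exterior_Re_kernel u c r : 0 < r -> 0 < c ->
  `|\int[leb]_x (\1_(exterior r) x * Re (kernel (u -i* c) x))| <=
  2 * `|u| * r / c ^+ 2.
Proof.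
move=> r0 c0; have w0 : Im (u -i* c) < 0 by rewrite /= oppr_lt0.
pose g x := x^-1 + (u - x) / ((u - x) ^+ 2 + c ^+ 2).
pose H x := ln (x ^+ 2) / 2 - ln ((u - x) ^+ 2 + c ^+ 2) / 2.
have c20 : 0 < c ^+ 2 by rewrite exprn_gt0.
have ig := integrable_exterior_Re_kernel r0 w0.
have gE : (fun x => \1_(exterior r) x * Re (kernel (u -i* c) x)) =
    (fun x => \1_(exterior r) x * g x).
  by apply/funext => x; rewrite Re_kernel.
rewrite gE in ig *.
have dH x : r <= `|x| -> is_derive x 1 H (g x).
  move=> rx; apply: is_derive_kernel_primitive => //.
  by rewrite -normr_gt0 (lt_le_trans r0).
have cg x : r <= `|x| -> {for x, continuous g}.
  move=> rx; have x0 : x != 0 by rewrite -normr_gt0 (lt_le_trans r0).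
  have cu : (fun y : R => u - y) y @[y --> x] --> u - x.
    by apply: cvgB; [exact: cvg_cst|exact: cvg_id].
  apply: cvgD; first exact: cvgV.
  apply: cvgM => //; apply: cvgV; first by rewrite gt_eqF// ltr_wpDl ?sqr_ge0.
  apply: cvgD; last exact: cvg_cst.
  by rewrite expr2; under eq_fun do rewrite expr2; exact: cvgM.
have HL : H n%:R - H (- n%:R) @[n --> \oo] --> (0 : R).
  rewrite (_ : (fun n => _) = (fun n : nat => (ln ((u + n%:R) ^+ 2 + c ^+ 2) -
    ln ((u - n%:R) ^+ 2 + c ^+ 2)) / 2)).
    exact: kernel_primitive_cvg.
  by apply/funext => n; rewrite /H sqrrN opprK; lra.
rewrite (Rintegral_exterior r0 dH cg ig HL).
rewrite add0r /H sqrrN opprK.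
rewrite (_ : _ - _ = (ln ((u - r) ^+ 2 + c ^+ 2) - ln ((u + r) ^+ 2 + c ^+ 2))
  / 2); last by lra.
rewrite normrM [`|2^-1|]ger0_norm// ler_pdivrMr//.
apply: (le_trans (ler_dist_ln c20 _ _)); try by rewrite lerDr sqr_ge0.
rewrite (_ : _ - _ = - (4 * u * r)); last by ring.
rewrite normrN !normrM [`|4|]ger0_norm// [`|r|]gtr0_norm//.
by rewrite [leRHS](_ : _ = 4 * `|u| * r / c ^+ 2)//; field; rewrite gt_eqF.
Qed.

Lemma integrable_exterior_monomial (j : nat) r : 0 < r ->
  leb.-integrable setT (EFin \o (fun x => \1_(exterior r) x * (x ^+ j.+2)^-1)).
Proof.
move=> r0.
apply: (le_Rintegrable measurableT _ _
  (RintegrableZl measurableT (r ^+ j)^-1 (integrable_exterior_inv2 r0))).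
  apply: measurable_funM; first by apply: measurable_indic;
    exact: measurable_exterior.
  by apply: (measurableT_comp measurable_invr); exact: exprn_measurable.
move=> x _; have [rx|rx] := leP r `|x|; last first.
  by rewrite !indic_exterior0// !mul0r normr0 mulr0.
have x0 : 0 < `|x| by exact: lt_le_trans rx.
rewrite !indic_exterior1// !mul1r normfV normrX -invfM.
have x20 : 0 < x ^+ 2 by rewrite -(real_normK (num_real x)) exprn_gt0.
have rj : 0 < r ^+ j by exact: exprn_gt0.
have xj : 0 < `|x| ^+ j.+2 by exact: exprn_gt0.
rewrite lef_pV2 ?posrE ?(mulr_gt0 rj x20)//.
rewrite -(real_normK (num_real x)) -[in X in _ <= X]addn2 exprD.
by rewrite ler_pM2r ?exprn_gt0// lerXn2r// nnegrE ltW.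
Qed.

(** By parity the value is 0 for even [j]. The uniform form [(1 - (-1)^j) / j] is kept because the
    integral of [sin (j t)] over [[0, pi]] has the same one, which is how exterior and contour
    integrals are matched. *)
Lemma Rintegral_exterior_monomial (j : nat) r : 0 < r -> (0 < j)%N ->
  \int[leb]_x (\1_(exterior r) x * (x ^+ j.+1)^-1) =
  (1 - (-1) ^+ j) / (j%:R * r ^+ j).
Proof.
move=> r0 j0; have jR0 : (0 : R) < j%:R by rewrite ltr0n.
pose H x := - (j%:R * x ^+ j)^-1.
have dH x : r <= `|x| -> is_derive x 1 H (x ^+ j.+1)^-1.
  move=> rx; have x0 : x != 0 by rewrite -normr_gt0 (lt_le_trans r0).
  have d1 : is_derive x (1 : R) (fun y => j%:R * y ^+ j) (j%:R * (j%:R * x ^+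
    j.-1)).
    have -> : (fun y : R => j%:R * y ^+ j) = j%:R \*: ((@id R) ^+ j).
      by apply/funext => y; rewrite [RHS]/= exprfctE.
      by apply: is_derive_eq; rewrite /GRing.scale /= mulr1.
  have dx0 : j%:R * x ^+ j != 0 by rewrite mulf_neq0 ?expf_neq0// gt_eqF.
  have d2 := @is_deriveV R (fun y => j%:R * y ^+ j) x _ _ dx0 d1.
  have -> : H = - (fun y => (j%:R * y ^+ j)^-1) by [].
  apply: is_derive_eq; rewrite /GRing.scale /= mulNr opprK.
  case: j j0 jR0 {H d1 d2} dx0 => // j _ jR0 _ /=.
  rewrite !exprS; field.
  by rewrite x0 expf_neq0// gt_eqF.
have cg x : r <= `|x| -> {for x, continuous (fun x : R => (x ^+ j.+1)^-1)}.
  move=> rx; have x0 : x != 0 by rewrite -normr_gt0 (lt_le_trans r0).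
  by apply: cvgV; [rewrite expf_neq0|exact: exprn_continuous].
have ig : leb.-integrable setT (EFin \o (fun x => \1_(exterior r) x * (x ^+
  j.+1)^-1)).
  by case: j j0 {jR0 H dH cg} => // j _; exact: integrable_exterior_monomial.
have HL : H n%:R - H (- n%:R) @[n --> \oo] --> (0 : R).
  rewrite (_ : (fun n => _) = (fun n : nat => ((-1) ^+ j - 1) / j%:R *
    (n%:R^-1) ^+ j)).
    rewrite -(mulr0 (((-1) ^+ j - 1) / j%:R)); apply: cvgMl_tmp.
    rewrite (_ : 0 = 0 ^+ j :> R); last by rewrite expr0n -(prednK j0).
    apply: (cvg_comp (fun n : nat => n%:R^-1 : R) (fun y => y ^+ j));
      last exact: exprn_continuous.
    apply/cvgr0Pnorm_le => e e0; near=> n.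
    have ne : e^-1 <= n%:R by near: n; exact: nbhs_infty_ger.
    rewrite ger0_norm ?invr_ge0//.
    rewrite -[leRHS]invrK lef_pV2// posrE ?invr_gt0//.
    by rewrite (lt_le_trans _ ne)// invr_gt0.
  apply/funext => n; rewrite /H (exprNn n%:R) exprVn !invfM.
  have ss : (-1) ^+ j = ((-1) ^+ j)^-1 :> R by rewrite -exprVn invrN invr1.
  by rewrite -ss; lra.
rewrite (Rintegral_exterior r0 dH cg ig HL).
rewrite add0r /H (exprNn r) opprK.
rewrite (_ : (-1) ^+ j * _ = (-1) ^+ j * r ^+ j)//.
have s0 : (-1) ^+ j != 0 :> R by rewrite expf_neq0// oppr_eq0 oner_eq0.
have ss : (-1) ^+ j = ((-1) ^+ j)^-1 :> R.
  by rewrite -exprVn invrN invr1.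
have rj0 : r ^+ j != 0 by rewrite expf_neq0// gt_eqF.
rewrite [in RHS]ss; field.
by rewrite s0 rj0 gt_eqF.
Unshelve. all: by end_near. Qed.

End nontangential_kernel.

(** * Laurent tails and the first complex moment *)

Section laurent_tail.
Context {R : realType}.
Local Notation leb := (@lebesgue_measure R : {measure set (measurableTypeR R)
  -> \bar R}).

Lemma big_nat_shift2 (V : nmodType) (f : nat -> V) n :
  \sum_(2 <= k < n + 2) f k = \sum_(j < n) f j.+2.
Proof.
rewrite (_ : 2%N = (0 + 2)%N)// big_addn addnK big_mkord.
by apply: eq_bigr => j _; rewrite addn2.
Qed.

Lemma cvg_sum_abs_bounded (v : nat -> R) (B : R) :
  (forall n, \sum_(j < n) `|v j| <= B) -> exists l : R,
    \sum_(j < n) v j @[n --> \oo] --> l.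
Proof.
move=> vB; have : cvgn [normed series v].
  apply: nondecreasing_is_cvgn;
    first exact: (@nondecreasing_series R (fun k => `|v k|) xpredT 0%N (fun _ _
    _ => normr_ge0 _)).
  exists B => _ [n _ <-]; have := vB n.
  by rewrite -(big_mkord xpredT (fun j => `|v j|)).
move=> /normed_cvg/cvg_ex[l vl]; exists l.
by under eq_fun do rewrite -(big_mkord xpredT v).
Qed.

Variables (a : nat -> R) (R0 : R).
Hypothesis R0_gt0 : 0 < R0.
Hypothesis cva : cvgn (fun n => \sum_(2 <= k < n) `|a k / R0 ^+ k|).

Let B := limn (fun n => \sum_(2 <= k < n) `|a k / R0 ^+ k|).

Lemma le_sum_abs_laurent n : \sum_(j < n) `|a j.+2 / R0 ^+ j.+2| <= B.
Proof.
rewrite -(big_nat_shift2 (fun k => `|a k / R0 ^+ k|)).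
by apply: (nondecreasing_cvgn_le _ cva (n + 2));
  exact: (@nondecreasing_series R (fun k => `|a k / R0 ^+ k|) xpredT 2%N (fun _
    _ _ => normr_ge0 _)).
Qed.

Lemma laurent_cvg x : R0 <= `|x| ->
  \sum_(j < n) a j.+2 / x ^+ j.+2 @[n --> \oo] --> laurent_tail a x.
Proof.
move=> Rx; have x0 : 0 < `|x| by exact: lt_le_trans Rx.
have [|l vl] := @cvg_sum_abs_bounded (fun j => a j.+2 / x ^+ j.+2) B.
  move=> n; apply: le_trans (le_sum_abs_laurent n); apply: ler_sum => j _.
  rewrite !normrM !normfV !normrX (gtr0_norm R0_gt0) ler_wpM2l// lef_pV2 ?posrE
    ?exprn_gt0//.
  by rewrite lerXn2r// nnegrE ltW.
suff -> : laurent_tail a x = l by [].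
apply: cvg_lim => //; rewrite -(cvg_shiftn 2) /=.
by under eq_fun do rewrite big_nat_shift2.
Qed.

(** The remainder of [x p(x)], not of [p]: without its [1 / x] term it is O(x^-2), hence
    integrable. *)
Definition laurent_remainder (x : measurableTypeR R) : R :=
  \1_(exterior R0) x * (x * laurent_tail a x - a 2%N / x).

Let rem n (x : measurableTypeR R) : R :=
  \1_(exterior R0) x * \sum_(j < n) a j.+3 / x ^+ j.+2.

Let rem_cvg x : rem n x @[n --> \oo] --> laurent_remainder x.
Proof.
rewrite /rem /laurent_remainder; have [Rx|Rx] := leP R0 `|x|; last first.
  by rewrite !indic_exterior0// mul0r; under eq_fun do rewrite mul0r;
    exact: cvg_cst.
have x0 : x != 0 by rewrite -normr_gt0 (lt_le_trans R0_gt0).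
apply: cvgMl_tmp.
rewrite (_ : (fun n => _) = (fun n => x * (\sum_(j < n.+1) a j.+2 / x ^+ j.+2)
  - a 2%N / x)).
  apply: cvgB; last exact: cvg_cst.
  apply: cvgMl_tmp; have := laurent_cvg Rx; rewrite -(cvg_shiftn 1) /=.
  by under eq_fun do rewrite addn1.
apply/funext => n; rewrite big_ord_recl mulrDr.
rewrite (_ : x * (a 2%N / x ^+ 2) = a 2%N / x); last by field.
rewrite addrC addKr mulr_sumr; apply: eq_bigr => j _.
rewrite lift0 [x ^+ _.+3]exprS; field.
by rewrite x0 expf_neq0.
Qed.

(** Termwise, [R0^(j+3) / |x|^(j+2)] equals [R0^3 x^-2 (R0 / |x|)^j], and the last factor is at most
    1. The bounding sum has one more term, the one of [a_2], which is non-negative. *)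
Let rem_le n x : `|rem n x| <= R0 ^+ 3 * B * (\1_(exterior R0) x * (x ^+ 2)^-1).
Proof.
rewrite /rem; have [Rx|Rx] := leP R0 `|x|; last first.
  by rewrite !indic_exterior0// !mul0r normr0 mulr0.
rewrite !indic_exterior1// !mul1r.
have x0 : 0 < `|x| by exact: lt_le_trans Rx.
have x20 : 0 < x ^+ 2 by rewrite -(real_normK (num_real x)) exprn_gt0.
have c0 : 0 <= R0 ^+ 3 * (x ^+ 2)^-1.
  by apply: mulr_ge0; [rewrite exprn_ge0// ltW|rewrite invr_ge0 ltW].
apply: (le_trans (ler_norm_sum _ _ _)).
apply: (@le_trans _ _ (R0 ^+ 3 * (x ^+ 2)^-1 * \sum_(j < n.+1) `|a j.+2 / R0 ^+
  j.+2|)); last first.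
  rewrite [leRHS]mulrAC ler_wpM2l ?le_sum_abs_laurent//.
rewrite big_ord_recl mulrDr -[leLHS]add0r lerD//; first exact: mulr_ge0.
rewrite mulr_sumr; apply: ler_sum => j _.
rewrite !normrM mulrCA ler_wpM2l// !normfV !normrX (gtr0_norm R0_gt0).
rewrite -(real_normK (num_real x)) lift0.
rewrite [X in _ <= X](_ : _ = (`|x| ^+ 2 * R0 ^+ j)^-1); last first.
  by rewrite -[j.+3]addn3 exprD; field; rewrite !expf_neq0 ?gt_eqF.
rewrite lef_pV2 ?posrE; last 2 first.
- exact: exprn_gt0.
- by apply: mulr_gt0; exact: exprn_gt0.
rewrite -[j.+2]addn2 exprD mulrC ler_wpM2r ?exprn_ge0//.
by rewrite lerXn2r// nnegrE ltW.
Qed.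

Let integrable_mono j : leb.-integrable setT
  (EFin \o (fun x => a j.+3 * (\1_(exterior R0) x * (x ^+ j.+2)^-1))).
Proof. by apply: RintegrableZl => //; exact: integrable_exterior_monomial. Qed.

Let measurable_rem n : measurable_fun setT (rem n).
Proof.
apply: measurable_funM; first by apply: measurable_indic;
  exact: measurable_exterior.
apply: measurable_sum => j; apply: measurable_funM => //.
by apply: (measurableT_comp measurable_invr); exact: exprn_measurable.
Qed.

Let Rintegral_rem n : leb.-integrable setT (EFin \o rem n) /\
  \int[leb]_x rem n x =
  \sum_(j < n) a j.+3 * ((1 - (-1) ^+ j.+1) / (j.+1%:R * R0 ^+ j.+1)).
Proof.
elim: n => [|n [IHi IH]].
  rewrite big_ord0 (_ : rem 0 = cst 0); last first.
    by apply/funext => x; rewrite /rem big_ord0 mulr0.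
  by split; [exact: integrable0|rewrite Rintegral_cst// mul0r].
have -> : rem n.+1 = (fun x => rem n x + a n.+3 * (\1_(exterior R0) x * (x ^+
  n.+2)^-1)).
  by apply/funext => x; rewrite /rem big_ord_recr /= mulrDr mulrCA.
split; first by apply: RintegrableD.
rewrite (RintegralD measurableT IHi (integrable_mono n)) IH big_ord_recr /=;
  congr (_ + _).
by rewrite RintegralZl ?Rintegral_exterior_monomial//;
  exact: integrable_exterior_monomial.
Qed.

(** Termwise integration, by dominated convergence with a multiple of [x^-2]. The explicit series is
    what the real part of the contour integral also turns into. *)
Lemma laurent_remainder_integrable_cvg :
  leb.-integrable setT (EFin \o laurent_remainder) /\
  \sum_(j < n) a j.+3 * ((1 - (-1) ^+ j.+1) / (j.+1%:R * R0 ^+ j.+1)) @[n -->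
    \oo] -->
    \int[leb]_x laurent_remainder x.
Proof.
have [] := Rdominated_convergence measurableT measurable_rem (fun x _ =>
  @rem_cvg x)
  (RintegrableZl measurableT (R0 ^+ 3 * B) (integrable_exterior_inv2 R0_gt0))
  (fun n x _ => @rem_le n x).
move=> iq; under eq_fun do rewrite (Rintegral_rem _).2.
by split.
Qed.

Lemma laurent_remainder_le x :
  `|laurent_remainder x| <= R0 ^+ 3 * B * (\1_(exterior R0) x * (x ^+ 2)^-1).
Proof.
have cn : `|rem n x| @[n --> \oo] --> `|laurent_remainder x|.
  by apply: cvg_norm; exact: rem_cvg.
by apply: (cvgr_to_le cn); apply: nearW => n; exact: rem_le.
Qed.

Lemma exterior_laurentE x : \1_(exterior R0) x * (x * laurent_tail a x) =
  a 2%N * (\1_(exterior R0) x * x^-1) + laurent_remainder x.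
Proof. by rewrite /laurent_remainder; ring. Qed.

(** Measurability is read off from the integrable remainder, after adding the [a_2] term and
    dividing by [x]; off the exterior set both sides are 0. *)
Lemma measurable_exterior_laurent :
  measurable_fun setT (fun x => laurent_tail a x * \1_(exterior R0) x).
Proof.
rewrite (_ : (fun x => _) =
  (fun x => x^-1 * (a 2%N * (\1_(exterior R0) x * x^-1) + laurent_remainder
    x))).
  apply: measurable_funM; first exact: measurable_invr.
  apply: measurable_funD.
    apply: measurable_funM => //; apply: measurable_funM;
      last exact: measurable_invr.
    by apply: measurable_indic; exact: measurable_exterior.
  by apply/measurable_EFinP;
    apply: measurable_int (laurent_remainder_integrable_cvg).1.
apply/funext => x; rewrite -exterior_laurentE; have [Rx|Rx] := leP R0 `|x|.
  have x0 : x != 0 by rewrite -normr_gt0 (lt_le_trans R0_gt0).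
  by rewrite indic_exterior1//; field.
by rewrite indic_exterior0// !mul0r !mulr0.
Qed.

Lemma laurent_coef2_ge0 : (forall x,
  R0 <= `|x| -> 0 <= laurent_tail a x) -> 0 <= a 2%N.
Proof.
move=> p0; rewrite leNgt; apply/negP => a0.
pose C := R0 ^+ 3 * B.
(* Non-negativity of [x p(x)], multiplied by [x^2], forces [a_2 x + C >= 0]. At this point
   [a_2 x = a_2 (R0 + 1) - |C|], which makes the sum negative. *)
pose x := R0 + `|C| / (- a 2%N) + 1.
have C0 : 0 <= `|C| / (- a 2%N) by rewrite divr_ge0// oppr_ge0 ltW.
have x0 : 0 < x by rewrite /x addr_gt0 ?ltr_pwDl.
have xR : R0 <= `|x| by rewrite gtr0_norm// /x -addrA lerDl addr_ge0.
have xE : a 2%N * x = a 2%N * (R0 + 1) - `|C|.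
  by rewrite /x; field; rewrite lt_eqF.
move: x xE x0 xR => x xE x0 xR.
have := laurent_remainder_le x;
  rewrite -/C indic_exterior1// mul1r ler_norml => /andP[_].
have := exterior_laurentE x; rewrite indic_exterior1// !mul1r => rE.
have : 0 <= x * laurent_tail a x by rewrite mulr_ge0 ?p0// ltW.
rewrite rE => h1 h2.
have : 0 <= (a 2%N / x + C / x ^+ 2) * x ^+ 2.
  by rewrite mulr_ge0 ?sqr_ge0//; move: h1 h2; lra.
rewrite (_ : _ * _ = a 2%N * x + C); last by field; rewrite gt_eqF.
rewrite xE.
have : a 2%N * (R0 + 1) < 0 by rewrite nmulr_rlt0// addr_gt0.
by have := ler_norm C; lra.
Qed.

End laurent_tail.

Section complex_limits.
Context {R : realType}.
Local Open Scope complex_scope.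
Local Notation Re := complex.Re.
Local Notation Im := complex.Im.

Local Notation C := (R[i] : numFieldType).

Lemma complex_limn (w : nat -> C) (l : C) :
  Re (w n) @[n --> \oo] --> Re l -> Im (w n) @[n --> \oo] --> Im l ->
  limn w = l.
Proof.
move=> /cvgrPdist_le cRe /cvgrPdist_le cIm.
apply: (@cvg_lim C); first exact: (@norm_hausdorff C C).
(* In the order of [R[i]], [0 < e] forces [e] to be real; half of [Re e] is given to each
   component. *)
apply/(@cvgrPdist_le C C) => e; rewrite ltcE => /andP[/eqP Ime Ree].
have e2 : 0 < Re e / 2 by rewrite divr_gt0.
move: (cRe _ e2) (cIm _ e2); apply: filterS2 => n h1 h2.
rewrite normc_def lecE /= Ime eqxx /=.
have -> : Num.sqrt (Re (l - w n) ^+ 2 + Im (l - w n) ^+ 2) = Normc.normc (l - w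
  n).
  by case: (l - w n).
apply: (le_trans (normc_le_ReIm _)); rewrite !(ReD, ImD, ReN, ImN); lra.
Qed.

End complex_limits.

(** * The contour integral over the half circle *)

Section contour.
Context {R : realType}.
Local Open Scope complex_scope.
Local Notation Re := complex.Re.
Local Notation Im := complex.Im.
Local Notation leb := (@lebesgue_measure R : {measure set (measurableTypeR R)
  -> \bar R}).
Implicit Types (t : R).

Lemma cos_natmul_pi (j : nat) : cos (j%:R * pi) = (-1) ^+ j :> R.
Proof.
elim: j => [|j IH]; first by rewrite mul0r cos0.
by rewrite -natr1 mulrDl mul1r cosDpi IH exprS mulN1r.
Qed.

Lemma sin_natmul_pi (j : nat) : sin (j%:R * pi) = 0 :> R.
Proof.
elim: j => [|j IH]; first by rewrite mul0r sin0.
by rewrite -natr1 mulrDl mul1r sinDpi IH oppr0.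
Qed.

Lemma de_moivre t (j : nat) :
  (cos t +i* sin t) ^+ j = cos (j%:R * t) +i* sin (j%:R * t).
Proof.
elim: j => [|j IH]; first by rewrite mul0r cos0 sin0.
rewrite exprS IH -natr1 mulrDl mul1r cosD sinD; apply/eqP.
by rewrite eq_complex /=; apply/andP; split; apply/eqP; ring.
Qed.

Lemma Rintegral_FTC2 (f F : R -> R) (u v : R) : u < v -> continuous f ->
  (forall x : R, is_derive x 1 F (f x)) -> \int[leb]_(x in `[u,
    v]) f x = F v - F u.
Proof.
move=> uv cf dF; rewrite /Rintegral (@continuous_FTC2 _ f F u v uv)//.
- exact: continuous_subspaceT.
- have cF : continuous F.
    move=> x; apply: differentiable_continuous.
    by rewrite -derivable1_diffP; exact: ex_derive.
  split.
  + by move=> x _; exact: ex_derive.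
  + by apply: cvg_at_right_filter; exact: cF.
  + by apply: cvg_at_left_filter; exact: cF.
- by move=> x _; rewrite derive1E; exact: derive_val.
Qed.

Lemma continuous_sinM (k : R) : continuous (fun t : R => sin (k * t)).
Proof.
move=> t; apply: (cvg_comp (fun t : R => k * t) (@sin R));
  last exact: continuous_sin.
by apply: cvgMl_tmp; exact: cvg_id.
Qed.

Lemma continuous_cosM (k : R) : continuous (fun t : R => cos (k * t)).
Proof.
move=> t; apply: (cvg_comp (fun t : R => k * t) (@cos R));
  last exact: continuous_cos.
by apply: cvgMl_tmp; exact: cvg_id.
Qed.

Lemma is_derive_mull (k t : R) : is_derive t (1 : R) (fun x : R => k * x) k.
Proof.
have -> : (fun x : R => k * x) = k \*: (@id R) by [].
by apply: is_derive_eq; rewrite /GRing.scale /= mulr1.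
Qed.

Lemma Rintegral_sin_natmul (j : nat) : (0 < j)%N ->
  \int[leb]_(t in `[0, pi]) sin (j%:R * t) = (1 - (-1) ^+ j) / j%:R.
Proof.
move=> j0; have jR : (j%:R : R) != 0 by rewrite pnatr_eq0 -lt0n.
have dF (t : R) : is_derive t (1 : R) (fun t => - (j%:R)^-1 * cos (j%:R * t))
  (sin (j%:R * t)).
  have dt := is_derive_mull j%:R t.
  have -> : (fun t : R => - (j%:R)^-1 * cos (j%:R * t)) =
    (- (j%:R)^-1) \*: (@cos R \o (fun x => j%:R * x)) by [].
  by apply: is_derive_eq; rewrite /GRing.scale /=; field.
rewrite (Rintegral_FTC2 (pi_gt0 R) (@continuous_sinM _) dF).
rewrite cos_natmul_pi mulr0 cos0; field.
by [].
Qed.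

Lemma Rintegral_cos_natmul (j : nat) : (0 < j)%N ->
  \int[leb]_(t in `[0, pi]) cos (j%:R * t) = 0.
Proof.
move=> j0; have jR : (j%:R : R) != 0 by rewrite pnatr_eq0 -lt0n.
have dF (t : R) : is_derive t (1 : R) (fun t => (j%:R)^-1 * sin (j%:R * t))
  (cos (j%:R * t)).
  have dt := is_derive_mull j%:R t.
  have -> : (fun t : R => (j%:R)^-1 * sin (j%:R * t)) =
    (j%:R)^-1 \*: (@sin R \o (fun x => j%:R * x)) by [].
  by apply: is_derive_eq; rewrite /GRing.scale /=; field.
rewrite (Rintegral_FTC2 (pi_gt0 R) (@continuous_cosM _) dF).
by rewrite sin_natmul_pi !mulr0 sin0 mulr0 subrr.
Qed.

End contour.

Section contour_moment.
Context {R : realType}.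
Local Open Scope complex_scope.
Local Notation Re := complex.Re.
Local Notation Im := complex.Im.
Local Notation leb := (@lebesgue_measure R : {measure set (measurableTypeR R)
  -> \bar R}).
Variables (a : nat -> R) (R0 : R).
Hypothesis R0_gt0 : 0 < R0.
Hypothesis cva : cvgn (fun n => \sum_(2 <= k < n) `|a k / R0 ^+ k|).
Let B := limn (fun n => \sum_(2 <= k < n) `|a k / R0 ^+ k|).
Implicit Types (t : R).

Let le_sum n : \sum_(j < n) `|a j.+2 / R0 ^+ j| <= R0 ^+ 2 * B.
Proof.
apply: (@le_trans _ _ (R0 ^+ 2 * \sum_(j < n) `|a j.+2 / R0 ^+ j.+2|));
  last first.
  by rewrite ler_wpM2l ?sqr_ge0//; exact: le_sum_abs_laurent.
rewrite mulr_sumr; apply: ler_sum => j _.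
rewrite -[X in _ <= X * _]ger0_norm ?sqr_ge0// -normrM.
rewrite (_ : R0 ^+ 2 * _ = a j.+2 / R0 ^+ j)//.
by rewrite [R0 ^+ j.+2]exprS [R0 ^+ j.+1]exprS; field;
  rewrite expf_neq0 ?gt_eqF.
Qed.

(** With [h j] the sine or cosine of [j t], these are the real and imaginary parts of the partial
    sums of [i z^2 p(z)] on the half circle. *)
Let sums (h : nat -> R -> R) n t := \sum_(j < n) a j.+2 / R0 ^+ j * h j t.

Let sums_le (h : nat -> R -> R) n t : (forall j t, `|h j t| <= 1) ->
  \sum_(j < n) `|a j.+2 / R0 ^+ j * h j t| <= R0 ^+ 2 * B.
Proof.
move=> h1; apply: le_trans (le_sum n); apply: ler_sum => j _.
by rewrite normrM ler_piMr.
Qed.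

Let sums_cvg (h : nat -> R -> R) t : (forall j t, `|h j t| <= 1) ->
  sums h n t @[n --> \oo] --> limn (fun n => sums h n t).
Proof.
move=> h1; have [l hl] :=
  @cvg_sum_abs_bounded _ (fun j => a j.+2 / R0 ^+ j * h j t) _ (fun n =>
  sums_le n t h1).
by apply/cvg_ex; exists l.
Qed.

(** The partial sums are bounded by the constant [R0^2 B], which is integrable on [[0, pi]], so the
    series may be integrated termwise. *)
Let Rintegral_sums (h : nat -> R -> R) : (forall j t, `|h j t| <= 1) ->
  (forall j, continuous (h j)) ->
  \sum_(j < n) a j.+2 / R0 ^+ j * \int[leb]_(t in `[0,
    pi]) h j t @[n --> \oo] -->
  \int[leb]_(t in `[0, pi]) limn (fun n => sums h n t).
Proof.
move=> h1 ch.
have mh j : measurable_fun setT (h j) by exact: continuous_measurable_fun.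
have mI : measurable (`[0,
  pi] : set (measurableTypeR R)) by exact: measurable_itv.
have Ifin : (leb [set` `[0, pi]%R] < +oo)%E.
  rewrite [X in (X < _)%E](@lebesgue_measure_itv R `[0, pi]) /=.
  by case: ifP => _; rewrite ?ltry.
have ic (k : R) : leb.-integrable `[0, pi] (EFin \o cst k).
  apply: measurable_bounded_integrable => //.
  by exists `|k|; split; [exact: num_real|move=> M kM x _; exact: ltW].
have ih j : leb.-integrable `[0, pi] (EFin \o h j).
  apply: (le_Rintegrable mI _ _ (ic 1)); last by move=> x _; exact: h1.
  by apply: measurable_funTS; exact: mh.
have ms n : measurable_fun `[0, pi] (sums h n).
  apply: measurable_sum => j; apply: measurable_funM => //.
  by apply: measurable_funTS; exact: mh.
have [_] := @Rdominated_convergence _ _ _ leb _ mI (sums h)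
  (fun t => limn (fun n => sums h n t)) (cst (R0 ^+ 2 * B)) ms
  (fun t _ => @sums_cvg h t h1) (ic _)
  (fun n t _ => le_trans (ler_norm_sum _ _ _) (sums_le n t h1)).
suff E n : leb.-integrable `[0, pi] (EFin \o sums h n) /\
  \int[leb]_(t in `[0, pi]) sums h n t =
  \sum_(j < n) a j.+2 / R0 ^+ j * \int[leb]_(t in `[0, pi]) h j t.
  by under eq_fun do rewrite (E _).2.
elim: n => [|n [IHi IH]].
  rewrite big_ord0 (_ : sums h 0 = cst 0); last by apply/funext => x;
    rewrite /sums big_ord0.
  by split; [exact: integrable0|rewrite Rintegral_cst// mul0r].
have -> : sums h n.+1 = (fun t => sums h n t + a n.+2 / R0 ^+ n * h n t).
  by apply/funext => t; rewrite /sums big_ord_recr.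
split; first by apply: RintegrableD => //; exact: RintegrableZl.
rewrite (RintegralD mI IHi (RintegrableZl mI _ (ih n))) IH big_ord_recr /=.
by rewrite RintegralZl.
Qed.

Let sinj (j : nat) t : R := sin (j%:R * t).
Let cosj (j : nat) t : R := cos (j%:R * t).
Let sinj1 j t : `|sinj j t| <= 1. Proof. by rewrite ler_norml sin_geN1 sin_le1.
  Qed.
Let cosj1 j t : `|cosj j t| <= 1. Proof. by rewrite ler_norml cos_geN1 cos_le1.
  Qed.

Lemma half_circle_neq0 t : half_circle R0 t != 0.
Proof.
apply/negP => /eqP zE; have := cos2Dsin2 t.
have /eqP := congr1 (@Re R) zE; rewrite /= mulf_eq0 gt_eqF//= => /eqP ->.
have /eqP := congr1 (@Im R) zE; rewrite /= mulf_eq0 gt_eqF//= => /eqP ->.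
by rewrite expr0n addr0 => /eqP; rewrite eq_sym oner_eq0.
Qed.

(** This is [i e^(- i j t) = sin (j t) + i cos (j t)]: the factor [i] makes the sines the real
    part. *)
Lemma half_circle_exprV t j :
  'i / half_circle R0 t ^+ j = (R0 ^+ j)^-1%:C * (sinj j t +i* cosj j t).
Proof.
have z0 := expf_neq0 j (half_circle_neq0 t).
apply: (mulIf z0); rewrite divfK//.
rewrite (_ : half_circle R0 t = R0%:C * (cos t +i* sin t)); last first.
  by apply/eqP; rewrite eq_complex /= !mul0r subr0 addr0 !eqxx.
rewrite exprMn de_moivre -rmorphXn /= mulrACA -rmorphM /= mulVf ?expf_neq0
  ?gt_eqF//.
rewrite mul1r; apply/eqP; rewrite eq_complex /sinj /cosj /=; apply/andP;
  split; apply/eqP.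
  by ring.
by rewrite -{1}(cos2Dsin2 (j%:R * t)); ring.
Qed.

(** The factor is [i z^2] because the integrand of the first moment is [z p(z) z'(t)] with
    [z'(t) = i z]. *)
Lemma laurent_half_circle t :
  'i * half_circle R0 t ^+ 2 * laurent_tail (fun k => (a k)%:C) (half_circle R0
    t) =
  limn (fun n => sums sinj n t) +i* limn (fun n => sums cosj n t).
Proof.
set z := half_circle R0 t; have z0 : z != 0 by exact: half_circle_neq0.
have i0 : 'i != 0 :> R[i] by rewrite eq_complex /= oner_eq0 andbF.
have iz0 : 'i * z ^+ 2 != 0 by rewrite mulf_neq0 ?expf_neq0.
set L := _ +i* _.
suff -> : laurent_tail (fun k => (a k)%:C) z = ('i * z ^+ 2)^-1 * L.
  by rewrite mulVKf.
have E n : \sum_(2 <= k < n + 2) (a k)%:C / z ^+ k =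
    ('i * z ^+ 2)^-1 * (sums sinj n t +i* sums cosj n t).
  rewrite big_nat_shift2; apply: (mulfI iz0); rewrite mulVKf//.
  elim: n => [|n IH].
    by rewrite big_ord0 mulr0 /sums !big_ord0.
  rewrite big_ord_recr mulrDr IH /= (_ : _ * ((a n.+2)%:C / _) =
    (a n.+2)%:C * ('i / z ^+ n)); last first.
    by rewrite -[n.+2]addn2 exprD; field; rewrite expf_neq0// z0.
  rewrite half_circle_exprV mulrA -rmorphM /= /sums !big_ord_recr /=.
  by apply/eqP; rewrite eq_complex /= !mul0r subr0 addr0 !eqxx.
have cs := @sums_cvg sinj t sinj1; have cc := @sums_cvg cosj t cosj1.
apply: complex_limn; rewrite ?(ReM, ImM) -(cvg_shiftn 2).
  rewrite (_ : [sequence _]_n = fun n => Re (('i * z ^+ 2)^-1) * sums sinj n t -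
      Im (('i * z ^+ 2)^-1) * sums cosj n t); last by apply/funext => n;
        rewrite /= E ReM.
  by apply: cvgB; apply: cvgMl_tmp.
rewrite (_ : [sequence _]_n = fun n => Re (('i * z ^+ 2)^-1) * sums cosj n t +
    Im (('i * z ^+ 2)^-1) * sums sinj n t); last by apply/funext => n;
      rewrite /= E ImM.
by apply: cvgD; apply: cvgMl_tmp.
Qed.

Lemma derive_half_circle t :
  (derive1 (fun v => Re (half_circle R0 v)) t +i* derive1 (fun v => Im
    (half_circle R0 v)) t) =
  'i * half_circle R0 t.
Proof.
have dc : is_derive t (1 : R) (fun v => R0 * cos v) (R0 * - sin t).
  have -> : (fun v => R0 * cos v) = R0 \*: (@cos R) by [].
  by apply: is_derive_eq.
have ds : is_derive t (1 : R) (fun v => R0 * sin v) (R0 * cos t).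
  have -> : (fun v => R0 * sin v) = R0 \*: (@sin R) by [].
  by apply: is_derive_eq.
rewrite /= !derive1E !derive_val; apply/eqP; rewrite eq_complex /=.
by apply/andP; split; apply/eqP; ring.
Qed.

(** The real part is a sine series whose integrals agree term by term with those of the remainder on
    the line, so uniqueness of limits identifies the sums. In the imaginary part every cosine except
    the constant [j = 0] integrates to 0, leaving [pi a_2]. *)
Lemma contour_first_moment :
  contour_integral (half_circle R0) 0 pi
    (fun z => z ^+ 1 * laurent_tail (fun k => (a k)%:C) z) =
  (\int[leb]_x laurent_remainder a R0 x) +i* (pi * a 2%N).
Proof.
have E t : half_circle R0 t ^+ 1 * laurent_tail (fun k => (a k)%:C)
  (half_circle R0 t) *
      (derive1 (fun v => Re (half_circle R0 v)) t +i* derive1 (fun v => Im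
        (half_circle R0 v)) t) =
    limn (fun n => sums sinj n t) +i* limn (fun n => sums cosj n t).
  by rewrite derive_half_circle -laurent_half_circle expr1; ring.
rewrite /contour_integral /Cintegral.
apply/eqP; rewrite eq_complex /=; apply/andP; split; apply/eqP.
- rewrite (_ : Rintegral _ _ _ = \int[leb]_(t in `[0,
  pi]) limn (fun n => sums sinj n t)); last first.
    by apply: eq_Rintegral => t _; rewrite E.
  have c1 := Rintegral_sums sinj1 (fun j => @continuous_sinM R j%:R).
  have [_ c2] := laurent_remainder_integrable_cvg R0_gt0 cva.
  (* The shift by one drops the index [j = 0], where [sin 0 = 0]; the sine series then starts at
     [a_3] like the remainder. *)
  apply: (cvg_unique _ _ c2) => //; move: c1; rewrite -(cvg_shiftn 1) /=.
  apply: cvg_trans; apply: near_eq_cvg; apply: nearW => n.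
  rewrite addn1 big_ord_recl /=.
  rewrite (_ : Rintegral _ _ _ = 0) ?mulr0 ?add0r; last first.
    rewrite -[RHS](mul0r (fine (leb [set` `[0, pi]%R]))) -Rintegral_cst//.
    by apply: eq_Rintegral => t _; rewrite /sinj mul0r sin0.
  apply: eq_bigr => j _; rewrite /bump add1n /sinj Rintegral_sin_natmul//.
  by rewrite invfM; ring.
- rewrite (_ : Rintegral _ _ _ = \int[leb]_(t in `[0,
  pi]) limn (fun n => sums cosj n t)); last first.
    by apply: eq_Rintegral => t _; rewrite E.
  have c1 := Rintegral_sums cosj1 (fun j => @continuous_cosM R j%:R).
  suff c2 : \sum_(j < n) a j.+2 / R0 ^+ j * \int[leb]_(t in `[0,
    pi]) cosj j t @[n --> \oo]
      --> pi * a 2%N by exact: (cvg_unique _ c1 c2).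
  rewrite -(cvg_shiftn 1).
  rewrite (_ : [sequence _]_n = cst (pi * a 2%N)); first exact: cvg_cst.
  apply/funext => n /=; rewrite addn1 big_ord_recl big1 ?addr0; last first.
    by move=> j _; rewrite lift0 /cosj Rintegral_cos_natmul// mulr0.
  rewrite /= expr0 divr1 mulrC; congr (_ * _).
  rewrite (_ : Rintegral _ _ _ = \int[leb]_(t in `[0, pi]) cst 1 t); last first.
    by apply: eq_Rintegral => t _; rewrite /cosj mul0r cos0.
  rewrite Rintegral_cst// mul1r [X in fine X](@lebesgue_measure_itv R `[0,
    pi]) /= lte_fin pi_gt0.
  by rewrite oppr0 addr0.
Qed.

End contour_moment.

(** * Asymptotics of the Cauchy transform at infinity *)

Section cauchy_transform_asymptotics.
Context {R : realType}.
Local Open Scope complex_scope.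
Local Notation Re := complex.Re.
Local Notation Im := complex.Im.
Local Notation normc := (@Normc.normc R).
Local Notation leb := (@lebesgue_measure R : {measure set (measurableTypeR R)
  -> \bar R}).
Local Notation probR := (probability (measurableTypeR R) R).
Local Notation measureR := {measure set (measurableTypeR R) -> \bar R}.
Implicit Types (w z : R[i]) (mu : probR) (nu lam : measureR).
Implicit Types (f : measurableTypeR R -> R).

(** Real and imaginary parts are estimated by one argument; [b%:R] is then [part b 1], and
    [(~~ b)%:R * pi] is the corresponding part of [i pi]. *)
Definition part (b : bool) z := if b then Re z else Im z.

Lemma part_le b z : `|part b z| <= normc z.
Proof. by case: b; [exact: normRe_le|exact: normIm_le]. Qed.

Lemma partD b z w : part b (z + w) = part b z + part b w.
Proof. by case: b; rewrite /part ?ReD ?ImD. Qed.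

Lemma partN b z : part b (- z) = - part b z.
Proof. by case: b; rewrite /part ?ReN ?ImN. Qed.

Lemma partZ b (r : R) z : part b (r%:C * z) = r * part b z.
Proof. by case: b; rewrite /part ?ReM ?ImM /= mul0r ?subr0 ?addr0. Qed.

Lemma part1 b : part b 1 = b%:R.
Proof. by case: b. Qed.

Lemma measurable_partV b z w : Im w < 0 ->
  measurable_fun setT (fun x : measurableTypeR R => part b (z * (w - x%:C)^-1)).
Proof.
move=> w0; have mRe := continuous_measurable_fun (continuous_ReV_subr w0).
have mIm := continuous_measurable_fun (continuous_ImV_subr w0).
case: b; rewrite /part.
  rewrite (_ : (fun x => _) = (fun x => Re z * Re (w - x%:C)^-1 - Im z * Im (w
    - x%:C)^-1)).
    by apply: measurable_funB; apply: measurable_funM.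
  by apply/funext => x; rewrite ReM.
rewrite (_ : (fun x => _) = (fun x => Re z * Im (w - x%:C)^-1 + Im z * Re (w -
  x%:C)^-1)).
  by apply: measurable_funD; apply: measurable_funM.
by apply/funext => x; rewrite ImM.
Qed.

Lemma subr_real_neq0 w (x : R) : Im w < 0 -> w - x%:C != 0.
Proof.
move=> w0; rewrite -normc_eq0 gt_eqF// (lt_le_trans _ (normc_subr_ge _ _))//.
by rewrite oppr_gt0.
Qed.

Lemma mul_rhoE w (x : R) : Im w < 0 -> w * rho w x = w ^+ 2 * (w - x%:C)^-1 - w.
Proof. by move=> w0; rewrite /rho; field; exact: subr_real_neq0. Qed.

Lemma mul_rho_realE w (x : R) : Im w < 0 -> w * rho w x = x%:C * (1 + rho w x).
Proof. by move=> w0; rewrite /rho; field; exact: subr_real_neq0. Qed.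

Lemma measurable_part_mul_rho b w : Im w < 0 ->
  measurable_fun setT (fun x : measurableTypeR R => part b (w * rho w x)).
Proof.
move=> w0; rewrite (_ : (fun x => _) =
    (fun x => part b (w ^+ 2 * (w - x%:C)^-1) + part b (- w))).
  by apply: measurable_funD => //; exact: measurable_partV.
by apply/funext => x; rewrite mul_rhoE// partD.
Qed.

Lemma measurable_part_rho b w : Im w < 0 ->
  measurable_fun setT (fun x : measurableTypeR R => part b (rho w x)).
Proof.
move=> w0; rewrite (_ : (fun x => _) = (fun x => x * part b (1 * (w -
  x%:C)^-1))).
  by apply: measurable_funM => //; exact: measurable_partV.
by apply/funext => x; rewrite mul1r /rho partZ.
Qed.

Lemma part_mul_rho_le b w (x : R) : Im w < 0 ->
  `|part b (w * rho w x)| <= normc w * (normc w / - Im w + 1).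
Proof.
move=> w0; rewrite (le_trans (part_le _ _))// Normc.normcM.
by rewrite ler_wpM2l ?normc_ge0// normc_rho_le1.
Qed.

(** The constant [w] goes under the integral because [mu] has mass one. *)
Lemma part_cauchy_transform b mu w : Im w < 0 ->
  part b (w ^+ 2 * cauchy_transform mu w - w) = \int[mu]_x part b (w * rho w x).
Proof.
move=> w0.
have iV b' : mu.-integrable setT (EFin \o (fun x => part b' (w - x%:C)^-1)).
  apply: (@integrable_prob _ mu _ (- Im w)^-1).
    by have := measurable_partV b' 1 w0; under eq_fun do rewrite mul1r.
  by move=> x; apply: (le_trans (part_le _ _)); exact: normcV_subr_le.
have muT : fine (mu setT) = 1 by rewrite probability_setT.
have iW : mu.-integrable setT (EFin \o cst (part b w)) by exact:
  finite_measure_integrable_cst.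
under eq_Rintegral do rewrite mul_rhoE// partD partN.
rewrite (RintegralB measurableT _ iW); last first.
  apply: (@integrable_prob _ mu _ (normc (w ^+ 2) * (- Im w)^-1)).
    exact: measurable_partV.
  move=> x; apply: (le_trans (part_le _ _)); rewrite Normc.normcM.
  by rewrite ler_wpM2l ?normc_ge0// normcV_subr_le.
rewrite Rintegral_cst// [fine _]muT mulr1 partD partN; congr (_ - _).
have iRe := iV true; have iIm := iV false.
case: b {iV iW}; rewrite /part.
  under [RHS]eq_Rintegral do rewrite ReM.
  rewrite (RintegralB measurableT (RintegrableZl measurableT _ iRe)
    (RintegrableZl measurableT _ iIm)).
  by rewrite (RintegralZl _ measurableT iRe) (RintegralZl _ measurableT iIm)
    ReM.
under [RHS]eq_Rintegral do rewrite ImM.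
rewrite (RintegralD measurableT (RintegrableZl measurableT _ iIm)
  (RintegrableZl measurableT _ iRe)).
by rewrite (RintegralZl _ measurableT iRe) (RintegralZl _ measurableT iIm) ImM.
Qed.

(** Both summands are finite measures because they are dominated by the probability [mu], so a
    bounded function is integrable for each. *)
Lemma Rintegral_measure_sum mu nu lam f (K : R) :
  (forall A, measurable A -> mu A = (nu A + lam A)%E) ->
  measurable_fun setT f -> (forall x, `|f x| <= K) ->
  [/\ nu.-integrable setT (EFin \o f), lam.-integrable setT (EFin \o f) &
      \int[mu]_x f x = \int[nu]_x f x + \int[lam]_x f x].
Proof.
move=> muE mf fK.
have bf : [bounded f x | x in setT].
  exists K; split; first exact: num_real.
  by move=> M KM x _; exact: le_trans (fK x) (ltW KM).
have muT : (mu setT < +oo)%E by rewrite (le_lt_trans (probability_le1 _ _))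
  ?ltry.
have inu : nu.-integrable setT (EFin \o f).
  apply: measurable_bounded_integrable => //.
  by apply: le_lt_trans muT; rewrite [leRHS]muE// leeDl.
have ilam : lam.-integrable setT (EFin \o f).
  apply: measurable_bounded_integrable => //.
  by apply: le_lt_trans muT; rewrite [leRHS]muE// leeDr.
split => //.
rewrite /Rintegral (eq_measure_integral (measure_add nu lam) (m1 := mu));
  last first.
  move=> A mA _; have E : measure_add nu lam A = (nu A + lam A)%E.
    exact: measure_addE.
  exact: etrans (muE _ mA) (esym E).
rewrite (integral_measure_add measurableT inu ilam).
by rewrite fineD//; exact: integrable_fin_num.
Qed.

Lemma Rintegral_supported nu (K : set (measurableTypeR R)) f : measurable K ->
  nu (~` K) = 0%E -> measurable_fun setT f ->
  \int[nu]_x f x = \int[nu]_(x in K) f x.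
Proof.
move=> mK nuK mf; rewrite [RHS]Rintegral_mkcond /Rintegral; congr fine.
apply: ae_eq_integral => //.
- exact/measurable_EFinP.
- apply/measurable_EFinP; apply/(measurable_restrictT _ mK).
  exact: measurable_funTS.
exists (~` K); split => //; first exact: measurableC.
move=> x /= H Kx; apply: H => _; rewrite patchE ifT//.
by apply/mem_set.
Qed.

Lemma integrable_exterior_part_kernel b w (r : R) : 0 < r -> Im w < 0 ->
  leb.-integrable setT (EFin \o (fun x => \1_(exterior r) x * part b (kernel w
    x))).
Proof.
by case: b; [exact: integrable_exterior_Re_kernel|exact:
  integrable_exterior_Im_kernel].
Qed.

(* Writing [w rho = x (1 + rho)], the compactly supported part and the
   remainder of order [x^-2] contribute their first moments in the limit, and
   the term [a_2 / x] contributes [a_2] times the integral of the kernel. *)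
Lemma part_cauchy_transform_bound b mu nu lam (r R0 : R) (a : nat ->
  R) (M k : R)
    (K : set R) :
  (forall A, measurable A -> mu A = (nu A + lam A)%E) ->
  compact K -> nu (~` K) = 0%E -> (forall x, K x -> `|x| <= M) ->
  A2_with r R0 a lam -> forall w, Im w < 0 -> normc w / - Im w + 1 <= k ->
  `|part b (w ^+ 2 * cauchy_transform mu w - w) -
    (b%:R * (\int[nu]_x x + \int[leb]_x laurent_remainder a R0 x) +
     a 2%N * \int[leb]_x (\1_(exterior R0) x * part b (kernel w x)))| <=
  M ^+ 2 / - Im w +
  k * \int[leb]_x (`|laurent_remainder a R0 x| * Num.min (`|x| / - Im w) 1).
Proof.
move=> muE cK nuK KM [r0 rR0 cva p0 lamE] w w0 wk.
have R0_gt0 : 0 < R0 by exact: lt_trans rR0.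
have {}cva : cvgn (fun n => \sum_(2 <= k < n) `|a k / R0 ^+ k|).
  by apply: cva; rewrite gtr0_norm.
have mK : measurable (K : set (measurableTypeR R)) by exact: compact_measurable.
have c0 : 0 < - Im w by rewrite oppr_gt0.
have mF := measurable_part_mul_rho b w0.
have mrho := measurable_part_rho b w0.
have Fb x := @part_mul_rho_le b w x w0.
have [inu ilam muI] := Rintegral_measure_sum muE mF Fb.
rewrite part_cauchy_transform// muI.
have [iq _] := laurent_remainder_integrable_cvg R0_gt0 cva.
have mq : measurable_fun setT (laurent_remainder a R0).
  by apply/measurable_EFinP; exact: measurable_int iq.
have inq : leb.-integrable setT (EFin \o (fun x => `|laurent_remainder a R0
  x|)).
  exact: integrable_norm iq.
have k0 : 0 <= k.
  by apply: le_trans wk; rewrite addr_ge0// divr_ge0 ?normc_ge0// ltW.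
have rho_k (x : R) : normc (rho w x) <= k by exact: le_trans (normc_rho_le1 _
  w0) wk.
(* On [K] the error [x rho] is at most [M] times [M / - Im w], and [nu K <= 1]. *)
have nuI : `|\int[nu]_x part b (w * rho w x) - b%:R * \int[nu]_x x| <= M ^+ 2 /
  - Im w.
  have nuKfin : (nu K <= 1)%E.
    apply: (@le_trans _ _ (mu K)); first by rewrite [leRHS]muE// leeDl.
    exact: probability_le1.
  have iK f : measurable_fun setT f -> (exists2 C : R, True & forall x,
    K x -> `|f x| <= C) ->
      nu.-integrable K (EFin \o f).
    move=> mf [C _ fC]; apply: measurable_bounded_integrable => //.
    - by apply: le_lt_trans nuKfin _; rewrite ltry.
    - exact: measurable_funTS.
    - exists C; split; first exact: num_real.
      by move=> C' CC' x Kx; exact: le_trans (fC x Kx) (ltW CC').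
  have iKx : nu.-integrable K (EFin \o (fun x : measurableTypeR R => x)).
    by apply: iK => //; exists M.
  rewrite (Rintegral_supported mK nuK mF) (Rintegral_supported mK nuK)//.
  rewrite -RintegralZl//.
  have iKF : nu.-integrable K (EFin \o (fun x => part b (w * rho w x))).
    by apply: iK => //; exists (normc w * (normc w / - Im w + 1)).
  have M0 : 0 <= M ^+ 2 / - Im w by rewrite divr_ge0 ?sqr_ge0// ltW.
  have iKc : nu.-integrable K (EFin \o cst (M ^+ 2 / - Im w)).
    by apply: iK => //; exists (M ^+ 2 / - Im w) => // x _; rewrite ger0_norm.
  apply: (le_trans (le_dist_Rintegral mK iKF (RintegrableZl mK _ iKx) iKc _)).
    move=> x Kx; rewrite mul_rho_realE// partZ partD part1 mulrDr.
    rewrite [b%:R * x]mulrC addrC addKr normrM.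
    rewrite expr2 -mulrA; apply: ler_pM => //; first exact: KM.
    apply: (le_trans (part_le _ _)).
    rewrite /rho Normc.normcM Normc.normcV normc_real.
    apply: ler_pM; rewrite ?invr_ge0 ?normc_ge0// ?KM//.
    have wx := normc_subr_ge w x.
    by rewrite lef_pV2// posrE (lt_le_trans c0).
  rewrite Rintegral_cst//; rewrite ler_piMr//.
  rewrite -[leRHS]/(fine 1%E) fine_le// ge0_fin_numE//.
  by apply: le_lt_trans nuKfin _; rewrite ltry.
pose S (x : measurableTypeR R) : R := \1_(exterior R0) x.
have irem : leb.-integrable setT
    (EFin \o (fun x => laurent_remainder a R0 x * part b (1 + rho w x))).
  apply: (le_Rintegrable measurableT _ _ (RintegrableZl measurableT (1 + k)
    inq)).
    apply: measurable_funM => //.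
    rewrite (_ : (fun x => _) = (fun x => part b 1 + part b (rho w x))).
      exact: measurable_funD.
    by apply/funext => x; rewrite partD.
  move=> x _; rewrite normrM mulrC ler_wpM2r//.
  rewrite (le_trans (part_le _ _))// (le_trans (normcD _ _))//.
  by rewrite [normc 1](@Normc.normc1 R) lerD2l.
(* Here [x p(x)] is split into [a_2 / x] and the remainder; [(1 + rho) / x] is the kernel. *)
have lamI : \int[lam]_x part b (w * rho w x) =
    a 2%N * \int[leb]_x (S x * part b (kernel w x)) +
    \int[leb]_x (laurent_remainder a R0 x * part b (1 + rho w x)).
  have ikernel : leb.-integrable setT (EFin \o (fun x => S x * part b (kernel w
    x))).
    exact: integrable_exterior_part_kernel.
  rewrite (@Rintegral_density _ _ _ leb lam (fun x => laurent_tail a x * S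
    x))//.
  - rewrite -RintegralZl// -(RintegralD measurableT (RintegrableZl measurableT
    _ ikernel) irem).
    apply: eq_Rintegral => x _.
    rewrite mul_rho_realE// partZ.
    have [Rx|Rx] := leP R0 `|x|; last first.
      by rewrite /S /laurent_remainder indic_exterior0// !(mulr0, mul0r) addr0.
    have x0 : x != 0 by rewrite -normr_gt0 (lt_le_trans R0_gt0).
    have pE := exterior_laurentE a R0 x; rewrite indic_exterior1// !mul1r in pE.
    rewrite /S indic_exterior1// mul1r mulr1 mulrAC pE mulrDl; congr (_ + _).
    by rewrite -kernelE// partZ -mulrA mulKf.
  - exact: measurable_exterior_laurent.
  - move=> x; have [Rx|Rx] := leP R0 `|x|;
    last by rewrite /S indic_exterior0// mulr0.
    by rewrite mulr_ge0 ?p0// /S indicE.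
have remI : `|\int[leb]_x (laurent_remainder a R0 x * part b (1 + rho w x)) -
    b%:R * \int[leb]_x laurent_remainder a R0 x| <=
    k * \int[leb]_x (`|laurent_remainder a R0 x| * Num.min (`|x| / - Im w) 1).
  have imin : leb.-integrable setT
      (EFin \o (fun x => `|laurent_remainder a R0 x| * Num.min (`|x| / - Im w)
        1)).
    apply: (le_Rintegrable measurableT _ _ inq).
      apply: measurable_funM; first by apply: measurableT_comp => //;
        exact: normr_measurable.
      apply: measurable_minr => //.
      by apply: measurable_funM => //; exact: normr_measurable.
    move=> x _; rewrite normrM normr_id ler_piMr// ger0_norm ?ge_min ?lexx
      ?orbT//.
    by rewrite le_min ler01 andbT divr_ge0// ltW.
  rewrite -(RintegralZl _ measurableT iq) -(RintegralZl _ measurableT imin).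
  apply: (le_dist_Rintegral measurableT irem (RintegrableZl measurableT _ iq)
    (RintegrableZl measurableT _ imin)) => x _.
  rewrite partD part1 mulrDr [b%:R * _]mulrC addrC addKr normrM mulrCA
    ler_wpM2l//.
  apply: (le_trans (part_le _ _)); apply: (le_trans (normc_rho_le _ w0)).
  by rewrite ler_wpM2r// le_min ler01 andbT divr_ge0// ltW.
rewrite lamI.
move: nuI remI; rewrite -/S.
set I1 := \int[nu]_x part b (w * rho w x); set I2 := \int[nu]_x x.
set I3 := \int[leb]_x (S x * part b (kernel w x)).
set I4 := \int[leb]_x (_ * part b (1 + rho w x)).
set I5 := \int[leb]_x laurent_remainder a R0 x.
move=> h1 h2.
rewrite (_ : _ - _ = (I1 - b%:R * I2) + (I4 - b%:R * I5)); last by ring.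
by rewrite (le_trans (ler_normD _ _))// lerD.
Qed.

End cauchy_transform_asymptotics.

Section first_moment_asymptotics.
Context {R : realType}.
Local Open Scope complex_scope.
Local Notation Re := complex.Re.
Local Notation Im := complex.Im.
Local Notation normc := (@Normc.normc R).
Local Notation leb := (@lebesgue_measure R : {measure set (measurableTypeR R)
  -> \bar R}).
Local Notation probR := (probability (measurableTypeR R) R).

(** The cone turns the bound [2 |u| R0 / c^2] of the real part into [2 K R0 / c]; [K >= 1] lets the
    same expression cover the bound [2 R0 / c] of the imaginary part. *)
Lemma part_kernel_small b (w : R[i]) (R0 K : R) : 0 < R0 -> 1 <= K ->
  Im w < 0 ->
  `|Re w| <= K * - Im w ->
  `|\int[leb]_x (\1_(exterior R0) x * part b (kernel w x)) - (~~ b)%:R * pi| <=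
  2 * K * R0 / - Im w.
Proof.
case: w => u v /= R00 K1; rewrite -oppr_gt0 => c0 uK.
rewrite -(opprK v); move: (- v) c0 uK => c c0 uK; rewrite opprK.
case: b; rewrite /part /=.
  rewrite mul0r subr0; apply: (le_trans (Rintegral_exterior_Re_kernel u R00
    c0)).
  rewrite ler_pdivrMr ?exprn_gt0//.
  rewrite (_ : 2 * K * R0 / c * c ^+ 2 = 2 * (K * c) * R0); last by field;
    rewrite gt_eqF.
  by rewrite ler_wpM2r ?(ltW R00)// ler_wpM2l.
rewrite mul1r; apply: (le_trans (Rintegral_exterior_Im_kernel u R00 c0)).
rewrite ler_pM2r ?invr_gt0// ler_pM2r//; lra.
Qed.

(** The asymptotics are computed with the same decomposition and Laurent coefficients that define
    [m1], so the limit and the moment are the same expression. *)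
Lemma F_asymptotics_first_moment (mu : probR) (m1 : R[i]) :
  is_complex_moment mu 1 m1 -> F_asymptotics mu m1 /\ 0 <= Im m1.
Proof.
move=> [nu [lam [ml [[[Ks cK nuK] _ muE] [r [R0 [a [lamA mlE]]]] m1E]]]].
have [r0 rR0 cva p0 _] := lamA.
have R00 : 0 < R0 by exact: lt_trans rR0.
have {}cva : cvgn (fun n => \sum_(2 <= k < n) `|a k / R0 ^+ k|).
  by apply: cva; rewrite gtr0_norm.
rewrite (contour_first_moment R00 cva) in mlE.
have Rem1 : Re m1 = \int[nu]_x x + \int[leb]_x laurent_remainder a R0 x.
  by rewrite m1E mlE ReD.
have Imm1 : Im m1 = pi * a 2%N by rewrite m1E mlE ImD /= add0r.
split; last first.
  by rewrite Imm1 mulr_ge0 ?pi_ge0// (laurent_coef2_ge0 R00 cva p0).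
have partm1 b : part b m1 = b%:R * (\int[nu]_x x + \int[leb]_x
  laurent_remainder a R0 x) +
    a 2%N * ((~~ b)%:R * pi).
  by case: b; rewrite /part ?Rem1 ?Imm1 /= !(mul0r, mulr0,
    mul1r) ?addr0 ?add0r// mulrC.
have [M [_ /(_ (M + 1))]] := compact_bounded cK;
  rewrite ltrDl ltr01 => /(_ isT) KM.
have {}KM x : Ks x -> `|x| <= M + 1 by move=> Kx; exact: KM.
move: (M + 1) KM => {}M KM.
have [iq _] := laurent_remainder_integrable_cvg R00 cva.
have inq : leb.-integrable setT (EFin \o (fun x => `|laurent_remainder a R0
  x|)).
  exact: integrable_norm iq.
apply: F_asymptotics_of_cauchy_transform => K0 e e0.
pose K := Num.max K0 1; have K1 : 1 <= K by rewrite le_max lexx orbT.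
(* In the cone [|w| <= |Re w| + |Im w| <= (K + 1) (- Im w)], so the prefactor in the bound on [rho]
   is at most [K + 2]. *)
pose k := K + 2; have k0 : 0 < k by rewrite /k; lra.
have ek0 : 0 < e / 6 / k by rewrite !divr_gt0.
have [C C0 HC] := Rintegral_minr_cvg0 inq (fun x => normr_ge0 _) ek0.
(* [D] collects the two errors of order [1 / - Im w], from the compact part and from the kernel.
   They get [e / 6], the truncated remainder integral another [e / 6], which fits into [e / 2] for
   each of the two parts. *)
pose D := M ^+ 2 + `|a 2%N| * (2 * K * R0).
have D0 : 0 <= D.
  by rewrite addr_ge0 ?sqr_ge0// mulr_ge0// mulr_ge0 ?(ltW R00)//; lra.
exists (Num.max C (D / (e / 6))); first by rewrite lt_max C0.
move=> w; rewrite ge_max => /andP[Cw Dw] Kw.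
have w0 : Im w < 0 by rewrite -oppr_gt0 (lt_le_trans C0).
have c0 : 0 < - Im w by rewrite oppr_gt0.
have {}Kw : `|Re w| <= K * - Im w.
  by apply: (le_trans Kw); rewrite ler_pM2r// le_max lexx.
have wk : normc w / - Im w + 1 <= k.
  rewrite /k (_ : K + 2 = K + 1 + 1); last by ring.
  rewrite lerD2r ler_pdivrMr// (le_trans (normc_le_ReIm _))// mulrDl mul1r
    lerD//.
  by rewrite ltr0_norm.
have part_e b : `|part b (w ^+ 2 * cauchy_transform mu w - w - m1)| <= e / 2.
  have h1 := part_cauchy_transform_bound b muE cK nuK KM lamA w0 wk.
  have h2 := part_kernel_small b R00 K1 w0 Kw.
  have h3 := HC _ Cw.
  have h4 : D / - Im w <= e / 6.
    by rewrite ler_pdivrMr// mulrC -ler_pdivrMr// divr_gt0.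
  rewrite partD partN partm1.
  set P := part b _ in h1 *; set Q := _ * (_ + _) in h1 *.
  set I := \int[leb]_x (_ * part b (kernel w x)) in h1 h2.
  rewrite (_ : _ - _ = (P - (Q + a 2%N * I)) + a 2%N * (I - (~~ b)%:R * pi));
    last by ring.
  apply: (le_trans (ler_normD _ _)); rewrite normrM.
  have h5 := ler_wpM2l (normr_ge0 (a 2%N)) h2.
  apply: (le_trans (lerD h1 h5)).
  rewrite addrAC mulrA -mulrDl -/D.
  apply: (@le_trans _ _ (e / 6 + k * (e / 6 / k))).
    by rewrite lerD// ler_wpM2l// ltW.
  rewrite [k * _]mulrC divfK ?gt_eqF//; lra.
apply: (le_trans (normc_le_ReIm _)).
have := part_e true; have := part_e false; rewrite /part; lra.
Qed.

End first_moment_asymptotics.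

Theorem theorem3p3 (R : realType) (mu : probability (measurableTypeR R) R)
  (m1 : R[i]) (muM : nat -> probability (measurableTypeR R) R)
  (Pmu : P1 mu) (m1E : is_complex_moment mu 1 m1)
  (muME : forall N : nat, (0 < N)%N ->
    is_monotone_power (dilation (N%:R^-1) mu) N (muM N)) :
  weak_cvg muM (cauchy_prob (complex.Re m1) (complex.Im m1)).
Proof.
have [Fm m0] := F_asymptotics_first_moment m1E.
(* [m0] leaves the Dirac case [Im m1 = 0] and the density case [Im m1 > 0], which are treated
   together. *)
apply: (weak_cvg_cauchy_prob m0) => t y y0.
exact: poisson_monotone_limit Fm m0 muME y0.
Qed.
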